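(* Let $a,b>(p-1)/2$, let $PD(p)$ be the set of $p\times p$ (real symmetric) positive definite matrices, and let $S(U)=(s_{ij}(U))$ be a function from $\{U: 0<U<I_p\}$ to $LT(p)$. For $W=(W_1,W_2)\in PD(p)\times PD(p)$ let $T(W)$, $U(W)$, $g(W)=T(W)S(U(W))^{-1}$ and $z(W)\in\mathcal{Z}$ be as defined in the context. Suppose that the distribution of $W=(W_1,W_2)$ is given as \[ f_{\mathcal{G}}(g(W))(\det W_1)^{a-\frac{p+1}{2}}(\det W_2)^{b-\frac{p+1}{2}}dW_1dW_2 \] with some $f_{\mathcal{G}}:LT(p)\to\mathbb{R}$. Then $G=(g_{ij})=g(W)$ and $Z=z(W)$ are independent, and their joint distribution is given by \[ \frac{1}{c_0}f_{\mathcal{G}}(G)\prod_{i=1}^p g_{ii}^{2(a+b)-i}\,dG\times\nu_{\mathcal{Z}}(dZ), \] where $c_0=\int_{LT(p)}f_{\mathcal{G}}(G)\prod_{i=1}^p g_{ii}^{2(a+b)-i}dG$ and $\nu_{\mathcal{Z}}$ is a probability measure on $\mathcal{Z}$. Furthermore, $U=(u_{ij})=U(W)$ is independent of $G=g(W)$, and its distribution is given by \[ 2^pc_0\prod_{i=1}^p s_{ii}(U)^{2(a+b)+p-2i+1}(\det U)^{a-\frac{p+1}{2}}(\det(I_p-U))^{b-\frac{p+1}{2}}dU, \] where $dU=\prod_{1\le i\le j\le p}du_{ij}$.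
   Context: $LT(p)$ is the group of $p\times p$ real lower triangular matrices with positive diagonal elements, with $dG=\prod_{i\ge j}dg_{ij}$. For symmetric $A,B$, $A<B$ means $B-A\in PD(p)$; ${}^t$ denotes transpose. $dW_1=\prod_{1\le i\le j\le p}dw_{1,ij}$ and $dW_2=\prod_{1\le i\le j\le p}dw_{2,ij}$. For $W=(W_1,W_2)\in PD(p)\times PD(p)$, $T(W)\in LT(p)$ is defined by the Cholesky decomposition $T(W)T(W)^t=W_1+W_2$, and $U(W)=T(W)^{-1}W_1(T(W)^{-1})^t$, so that $W_1=TUT^t$, $W_2=T(I_p-U)T^t$ and $0<U(W)<I_p$. Put $z_U=\left(S(U)US(U)^t,\ S(U)(I_p-U)S(U)^t\right)$, $\mathcal{Z}=\{z_U:0<U<I_p\}$ and $z(W)=z_{U(W)}$. All functions are taken to be Borel measurable. *)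

(* Defs.v *)
From HB Require Import structures.
From mathcomp Require Import all_boot all_order all_algebra.
From mathcomp Require Import all_classical all_reals all_analysis.

Set Implicit Arguments.
Unset Strict Implicit.
Unset Printing Implicit Defensive.

Import Order.TTheory GRing.Theory Num.Theory.

Local Open Scope classical_set_scope.
Local Open Scope ring_scope.

(* The product sigma-algebra on matrices, generated by the entries, as the
   library does for n.-tuple T. Over the reals it is the Borel sigma-algebra. *)
Section measurable_matrix.
Context {d} {T : measurableType d}.
Variables m n : nat.

Definition mx_cylinder : set (set 'M[T]_(m, n)) :=
  [set A | exists i j, exists2 B : set T,
    measurable B & A = (fun M : 'M[T]_(m, n) => M i j) @^-1` B].

HB.instance Definition _ := @isMeasurable.Build (sigma_display mx_cylinder)
  'M[T]_(m, n) <<s mx_cylinder >> (@sigma_algebra0 _ setT mx_cylinder)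
  (@sigma_algebraC _ mx_cylinder) (@sigma_algebra_bigcup _ setT mx_cylinder).

Lemma measurable_entry i j :
  measurable_fun setT (fun M : 'M[T]_(m, n) => M i j).
Proof.
move=> _ B mB; rewrite setTI; apply: sub_sigma_algebra.
by exists i, j, B.
Qed.

Lemma measurable_fun_mxP d' (X : measurableType d') (f : X -> 'M[T]_(m, n)) :
  (forall i j, measurable_fun setT (fun x => f x i j)) ->
  measurable_fun setT f.
Proof.
move=> mf.
apply: (@measurability _ _ _ _ setT f mx_cylinder) => //.
move=> _ [_ [i [j [B mB ->]]] <-].
have := mf i j measurableT B mB.
by rewrite !setTI.
Qed.

End measurable_matrix.

(* The image of a sigma-finite measure under a measurable map that has a
   measurable left inverse is sigma-finite. *)
Section pushforward_sigma_finite.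
Context d1 d2 (T1 : measurableType d1) (T2 : measurableType d2) (R : realType).
Variables (mu : {measure set T1 -> \bar R}) (smu : sigma_finite setT mu).
Variables (f : T1 -> T2) (h : T2 -> T1).
Hypotheses (mf : measurable_fun setT f) (mh : measurable_fun setT h).
Hypothesis fK : cancel f h.

Definition push_sf of sigma_finite setT mu & measurable_fun setT f
  & measurable_fun setT h & cancel f h : set T2 -> \bar R :=
  pushforward mu f.

Local Notation nu := (push_sf smu mf mh fK).

Let nu0 : nu set0 = 0%E.
Proof. by rewrite /push_sf /pushforward preimage_set0 measure0. Qed.

Let nu_ge0 A : (0 <= nu A)%E.
Proof. exact: measure_ge0. Qed.

Let nu_sigma_additive : semi_sigma_additive nu.
Proof.
move=> F mF tF mUF; rewrite /push_sf /pushforward preimage_bigcup.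
apply: measure_semi_sigma_additive.
- by move=> n; rewrite -[X in measurable X]setTI; exact: mf.
- apply/trivIsetP => /= i j _ _ ij; rewrite -preimage_setI.
  by move/trivIsetP : tF => /(_ _ _ _ _ ij) ->//; rewrite preimage_set0.
- by rewrite -preimage_bigcup -[X in measurable X]setTI; exact: mf.
Qed.

HB.instance Definition _ := isMeasure.Build _ _ _ nu
  nu0 nu_ge0 nu_sigma_additive.

Let nu_sigma_finite : sigma_finite setT nu.
Proof.
have [F UF mF] := smu.
exists (fun n => h @^-1` F n); first by rewrite -preimage_bigcup -UF.
move=> n; have [mFn Fnoo] := mF n; split.
  by rewrite -[X in measurable X]setTI; exact: mh.
rewrite /push_sf /pushforward -comp_preimage.
by rewrite (_ : h \o f = id) //; apply/funext => x /=; rewrite fK.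
Qed.

HB.instance Definition _ := Measure_isSigmaFinite.Build _ _ _ nu
  nu_sigma_finite.

End pushforward_sigma_finite.

(* The library's SigmaFiniteMeasure instance on product measures is shadowed by
   the one for subprobabilities, whence a plain lemma. *)
Lemma sigma_finite_prod d1 d2 (T1 : measurableType d1)
    (T2 : measurableType d2) (R : realType)
    (m1 : {sigma_finite_measure set T1 -> \bar R})
    (m2 : {sigma_finite_measure set T2 -> \bar R}) :
  sigma_finite setT (m1 \x m2)%E.
Proof.
have /sigma_finiteP[F [TF ndF Foo]] := sigma_finiteT m1.
have /sigma_finiteP[G [TG ndG Goo]] := sigma_finiteT m2.
exists (fun n => F n `*` G n).
  rewrite -setXTT TF TG predeqE => -[x y]; split.
    move=> [/= [n _ Fnx] [k _ Gky]]; exists (maxn n k) => //; split.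
    - by move: x Fnx; exact/subsetPset/ndF/leq_maxl.
    - by move: y Gky; exact/subsetPset/ndG/leq_maxr.
  by move=> [n _ []/= ? ?]; split; exists n.
move=> k; have [? ?] := Foo k; have [? ?] := Goo k.
split; first exact: measurableX.
by rewrite product_measure1E// lte_mul_pinfty// ge0_fin_numE.
Qed.

Section lebesgue_tuple.
Variable R : realType.

Section cons.
Variable n : nat.

Definition tcons (x : measurableTypeR R * n.-tuple R) : n.+1.-tuple R :=
  [tuple of x.1 :: x.2].

Definition tuncons (t : n.+1.-tuple R) : measurableTypeR R * n.-tuple R :=
  (tnth t ord0, [tuple of behead t]).

Lemma measurable_tcons : measurable_fun setT tcons.
Proof.
apply/measurable_fun_tnthP => i.
have [->|i0] := eqVneq i ord0; first exact: measurable_fst.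
have i1n : (i.-1 < n)%N by rewrite prednK ?lt0n// -ltnS.
rewrite (_ : _ \o _ = (@tnth _ R ^~ (Ordinal i1n)) \o snd).
  by apply: measurableT_comp => //; exact: measurable_tnth.
apply/funext => x /=.
rewrite {1}(_ : i = lift ord0 (Ordinal i1n)) ?tnthS//.
by apply/val_inj => /=; rewrite /bump/= add1n prednK// lt0n.
Qed.

Lemma measurable_tuncons : measurable_fun setT tuncons.
Proof.
apply/measurable_fun_pairP; split; first exact: measurable_tnth.
exact: measurable_behead.
Qed.

Lemma tconsK : cancel tcons tuncons.
Proof. by case=> x t; congr pair; apply/val_inj. Qed.

End cons.

Fixpoint lebesgue_tuple (n : nat) :
    {sigma_finite_measure set (n.-tuple R) -> \bar R} :=
  match n with
  | 0 => \d_ [tuple]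
  | n.+1 =>
      push_sf (sigma_finite_prod (@lebesgue_measure R) (lebesgue_tuple n))
        (@measurable_tcons n) (@measurable_tuncons n) (@tconsK n)
  end.

End lebesgue_tuple.

Section triangular.
Variables (R : realType) (p : nat).

Definition tri := {ij : 'I_p * 'I_p | (ij.2 <= ij.1)%N}.

Definition tri_coord (t : #|{: tri}|.-tuple R) (i j : 'I_p) : R :=
  if insub (i, j) is Some k then tnth t (enum_rank (k : tri)) else 0.

Definition low_mx (t : #|{: tri}|.-tuple R) : 'M[R]_p :=
  \matrix_(i, j) tri_coord t i j.

Definition sym_mx (t : #|{: tri}|.-tuple R) : 'M[R]_p :=
  \matrix_(i, j) if (j <= i)%N then tri_coord t i j else tri_coord t j i.

Definition tri_part (M : 'M[R]_p) : #|{: tri}|.-tuple R :=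
  [tuple M (val (enum_val k)).1 (val (enum_val k)).2 | k < #|{: tri}|].

Lemma tri_coord_enum_val t (k : 'I_#|{: tri}|) :
  tri_coord t (val (enum_val k)).1 (val (enum_val k)).2 = tnth t k.
Proof. by rewrite /tri_coord -surjective_pairing valK enum_valK. Qed.

Lemma low_mxK : cancel low_mx tri_part.
Proof.
move=> t; apply: eq_from_tnth => k.
by rewrite tnth_mktuple mxE tri_coord_enum_val.
Qed.

Lemma sym_mxK : cancel sym_mx tri_part.
Proof.
move=> t; apply: eq_from_tnth => k.
by rewrite tnth_mktuple mxE (valP (enum_val k)) tri_coord_enum_val.
Qed.

Lemma measurable_tri_coord i j :
  measurable_fun setT (fun t : #|{: tri}|.-tuple R => tri_coord t i j).
Proof.
rewrite /tri_coord; case: insub => [k|]; last exact: measurable_cst.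
exact: measurable_tnth.
Qed.

Lemma measurable_low_mx : measurable_fun setT low_mx.
Proof.
apply: measurable_fun_mxP => i j.
rewrite (_ : (fun _ => _) = fun t => tri_coord t i j).
  exact: measurable_tri_coord.
by apply/funext => t; rewrite mxE.
Qed.

Lemma measurable_sym_mx : measurable_fun setT sym_mx.
Proof.
apply: measurable_fun_mxP => i j.
rewrite (_ : (fun _ => _) = fun t =>
  if (j <= i)%N then tri_coord t i j else tri_coord t j i).
  by case: (j <= i)%N; exact: measurable_tri_coord.
by apply/funext => t; rewrite mxE.
Qed.

Lemma measurable_tri_part : measurable_fun setT tri_part.
Proof.
apply/measurable_fun_tnthP => k.
rewrite (_ : _ \o _ =
  fun M : 'M[R]_p => M (val (enum_val k)).1 (val (enum_val k)).2).
  exact: measurable_entry.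
by apply/funext => M /=; rewrite tnth_mktuple.
Qed.

(* dG = \prod_(i >= j) dg_ij, as a measure on all matrices that is carried by
   the lower triangular ones *)
Definition lebesgue_low : {sigma_finite_measure set 'M[R]_p -> \bar R} :=
  push_sf (sigma_finiteT (lebesgue_tuple R #|{: tri}|))
    measurable_low_mx measurable_tri_part low_mxK.

(* dW = \prod_(i <= j) dw_ij, as a measure on all matrices that is carried by
   the symmetric ones *)
Definition lebesgue_sym : {sigma_finite_measure set 'M[R]_p -> \bar R} :=
  push_sf (sigma_finiteT (lebesgue_tuple R #|{: tri}|))
    measurable_sym_mx measurable_tri_part sym_mxK.

End triangular.
Arguments lebesgue_low {R} p.
Arguments lebesgue_sym {R} p.

Section matrices.
Variables (R : realType) (p : nat).
Implicit Types (A B U G : 'M[R]_p) (W : 'M[R]_p * 'M[R]_p).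

Definition PD : set 'M[R]_p :=
  [set A | A^T = A /\
           forall v : 'rV[R]_p, v != 0 -> 0 < (v *m A *m v^T) 0 0].

Definition mx_lt A B := PD (B - A).

Definition LT : set 'M[R]_p := [set G | is_trig_mx G /\ forall i, 0 < G i i].

Definition PD_unit : set 'M[R]_p := [set U | mx_lt 0 U /\ mx_lt U 1%:M].

(* Cholesky factor of W.1 + W.2; the default 0 is used only when W.1 + W.2 is
   not positive definite. *)
Definition T_of W : 'M[R]_p :=
  xget 0 [set T | LT T /\ T *m T^T = W.1 + W.2].

Definition U_of W : 'M[R]_p :=
  invmx (T_of W) *m W.1 *m (invmx (T_of W))^T.

Variable S : 'M[R]_p -> 'M[R]_p.

Definition g_of W : 'M[R]_p := T_of W *m invmx (S (U_of W)).

Definition z_at U : 'M[R]_p * 'M[R]_p :=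
  (S U *m U *m (S U)^T, S U *m (1%:M - U) *m (S U)^T).

Definition Zset : set ('M[R]_p * 'M[R]_p) := z_at @` PD_unit.

Definition z_of W := z_at (U_of W).

End matrices.
Arguments PD {R} p.
Arguments LT {R} p.
Arguments PD_unit {R} p.

Definition independent_rv d d1 d2 (Omega : measurableType d)
    (T1 : measurableType d1) (T2 : measurableType d2) (R : realType)
    (P : probability Omega R) (X : Omega -> T1) (Y : Omega -> T2) : Prop :=
  [/\ measurable_fun setT X, measurable_fun setT Y &
      forall A B, measurable A -> measurable B ->
        P (X @^-1` A `&` Y @^-1` B) = (P (X @^-1` A) * P (Y @^-1` B))%E].

(* Main.v *)
(* Writing W1 = T U T^t and W2 = T (I - U) T^t with T = G S(U), the measure
   dW1 dW2 becomes, up to the factor 2^p, a product of powers of the diagonal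
   entries of G and S(U) times dG dU: compose a translation of W2, the map
   T |-> T T^t, the congruence U |-> T U T^t and the right multiplication
   G |-> G S(U). Since the determinants of W1 and W2 also factor, the law of
   (G, U) is a product, and Z = z_U is a function of U.

   Each of these maps is triangular for a suitable order of the matrix entries,
   so that its Jacobian is obtained by Tonelli's theorem from one-dimensional
   affine or quadratic substitutions. *)
Require Import Defs.
From HB Require Import structures.
From mathcomp Require Import all_boot all_order all_algebra.
From mathcomp Require Import all_classical all_reals all_analysis.
From mathcomp Require Import measurable_realfun zify ring.

Set Implicit Arguments.
Unset Strict Implicit.
Unset Printing Implicit Defensive.

Import Order.TTheory GRing.Theory Num.Theory.
Import numFieldNormedType.Exports.

Local Open Scope classical_set_scope.
Local Open Scope ring_scope.

(** * Measures with a density and one-dimensional substitutions *)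

(** The definitions give no measurability: [T_of] is a choice, and [S] is arbitrary outside its
    domain. Hence the explicit Cholesky recursion on Schur complements, which agrees with the choice
    by uniqueness of the factor, and the variants of [U_of], [g_of] and [z_at] that are measurable
    everywhere. A triangular substitution with squares need not be onto: a diagonal entry of
    [T *m T^T] is a square plus a term in earlier entries, and can only exceed that term. The
    integrand has to vanish at the values that are missed. Positive definiteness ensures this,
    because the part of the Cholesky factor that precedes an entry is determined by the part of the
    matrix that precedes it. Tonelli and the substitutions are applied to nonnegative integrands
    only. Since [fG] is signed a priori, its negative part is first shown to carry no mass. The
    total probability 1 is then a product of two integrals in the extended reals, and this makes
    [c_0] finite and positive. *)

Section density.
Local Open Scope ereal_scope.
Context d (T : measurableType d) (R : realType).
Variables (mu : {measure set T -> \bar R}) (f : T -> R).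
Hypotheses (mf : measurable_fun setT f) (f0 : forall x, (0 <= f x)%R).

(** The two proofs are arguments so that the measure instance can be inferred from the term
    itself. *)
Definition density of measurable_fun setT f & (forall x, (0 <= f x)%R) :
  set T -> \bar R := fun A => \int[mu]_(x in A) (f x)%:E.

Local Notation nu := (density mf f0).

Let nu0 : nu set0 = 0. Proof. exact: integral_set0. Qed.

Let mEf : measurable_fun setT (EFin \o f).
Proof. exact/measurable_EFinP. Qed.

Let nu_ge0 A : 0 <= nu A.
Proof. by apply: integral_ge0 => x _; rewrite lee_fin. Qed.

Let nu_sigma_additive : semi_sigma_additive nu.
Proof.
move=> F mF tF mUF; rewrite /density ge0_integral_bigcup//.
- apply: is_cvg_ereal_nneg_natsum_cond => n _ _.
  by apply: integral_ge0 => x _; rewrite lee_fin.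
- exact: measurable_funS mEf.
- by move=> x _; rewrite lee_fin.
Qed.

HB.instance Definition _ := isMeasure.Build _ _ _ nu
  nu0 nu_ge0 nu_sigma_additive.

Import HBNNSimple.

(** For indicators this is the definition of [density]; increasing simple functions and monotone
    convergence do the rest. *)
Lemma ge0_integral_density (g : T -> \bar R) :
  measurable_fun setT g -> (forall x, 0 <= g x) ->
  \int[nu]_x g x = \int[mu]_x (g x * (f x)%:E).
Proof.
move=> mg g0; pose h := nnsfun_approx measurableT mg.
have mhf n : measurable_fun setT (fun x => (h n x)%:E * (f x)%:E).
  by apply: emeasurable_funM => //; exact/measurable_EFinP.
have hg x : (h n x)%:E @[n --> \oo] --> g x.
  by apply: cvg_nnsfun_approx => // y _; exact: g0.
transitivity (limn (fun n => \int[nu]_x (h n x)%:E)).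
  rewrite -monotone_convergence//=.
  - by apply: eq_integral => x _; apply/esym/cvg_lim => //; exact: hg.
  - by move=> n; exact/measurable_EFinP.
  - by move=> n x _; rewrite lee_fin.
  - by move=> x _ a b ab; rewrite lee_fin//; exact/lefP/nd_nnsfun_approx.
rewrite (_ : \int[mu]_x _ = limn (fun n => \int[mu]_x ((h n x)%:E * (f x)%:E))).
  congr (limn _); apply/funext => n.
  rewrite integralT_nnsfun sintegralE.
  transitivity (\int[mu]_x (\sum_(r \in range (h n))
      ((r * \1_(h n @^-1` [set r]) x)%:E * (f x)%:E))); last first.
    apply: eq_integral => x _; rewrite fimfunE -fsumEFin// ge0_mule_fsuml//.
    by move=> r; rewrite nnfun_muleindic_ge0.
  rewrite ge0_integral_fsum//; last 2 first.
  - by move=> r; apply: emeasurable_funM => //;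
    exact/measurable_EFinP/measurable_funM.
  - by move=> r x _; rewrite mule_ge0// ?nnfun_muleindic_ge0// lee_fin.
  apply: eq_fsbigr => r; rewrite inE => -[x _ <-].
  under [RHS]eq_integral do rewrite EFinM -muleA.
  rewrite ge0_integralZl//; last 3 first.
  - by apply: emeasurable_funM => //; exact/measurable_EFinP.
  - by move=> y _; rewrite mule_ge0// lee_fin.
  - by rewrite lee_fin.
  congr (_ * _); rewrite /density [LHS]integral_mkcond.
  apply: eq_integral => y _; rewrite patchE indicE.
  by case: ifPn; rewrite ?mul1e ?mul0e.
rewrite -monotone_convergence//=.
- apply: eq_integral => x _; apply/esym/cvg_lim => //.
  rewrite muleC; under eq_fun do rewrite muleC.
  exact: cvgeZl.
- by move=> n x _; rewrite mule_ge0// lee_fin.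
- move=> x _ a b ab; rewrite lee_wpmul2r// lee_fin//;
  exact/lefP/nd_nnsfun_approx.
Qed.

End density.

(** Kept transparent, so that its values reduce to those of [pushforward]. *)
Definition image_measure d1 d2 (T1 : measurableType d1) (T2 : measurableType d2)
    (R : realType) (mu : {measure set T1 -> \bar R}) (f : T1 -> T2)
    (mf : measurable_fun setT f) : {measure set T2 -> \bar R}.
Proof. by refine (pushforward mu f). Defined.

Lemma measurable_fun_patch d (T : measurableType d) (R : realType) (E : set T)
    (g : T -> \bar R) :
  measurable E -> measurable_fun setT g -> measurable_fun setT (g \_ E).
Proof.
by move=> mE mg; apply/(measurable_restrictT g mE); exact: measurable_funTS.
Qed.

Lemma measurable_forall d (X : measurableType d) (I : finType)
    (P : I -> X -> bool) :
  (forall i, measurable_fun setT (P i)) ->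
  measurable_fun setT (fun x => [forall i, P i x]).
Proof.
move=> mP; rewrite (_ : (fun _ => _) = fun x => all (P ^~ x) (enum I));
  last first.
  apply/funext => x; apply/forallP/allP => Px i; first by move=> _; exact: Px.
  by apply: Px; rewrite mem_enum.
by elim: (enum I) => [|i s IHs] //=; exact: measurable_and.
Qed.

Section affine_substitution.
Context {R : realType}.
Local Notation leb := (@lebesgue_measure R).
Implicit Type g : measurableTypeR R -> \bar R.

Lemma measurable_affine (c h : R) :
  measurable_fun setT (fun x : measurableTypeR R => c * x + h : measurableTypeR R).
Proof. by apply: measurable_funD => //; exact: measurable_funM. Qed.

(** Uniqueness of Lebesgue measure: the right side is a measure in [A] that gives half-open
    intervals their length. *)
Lemma lebesgue_measure_affine (c h : R) A : 0 < c -> measurable A ->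
  leb A = (c%:E * leb ((fun x => (c * x + h)%R) @^-1` A))%E.
Proof.
move=> c0; have mf := measurable_affine c h.
pose nu : {measure set (measurableTypeR R) -> \bar R} :=
  mscale (NngNum (ltW c0)) (image_measure leb mf).
move=> mA; apply: (@lebesgue_measure_unique R nu) => //.
move=> _ [[u v] _ <-] /=.
rewrite /nu /mscale/= /pushforward/=.
rewrite [X in (_ * leb X)%E](_ : _ = `](u - h) / c, (v - h) / c]%classic);
  last first.
  by apply/seteqP; split => x;
    rewrite /preimage/= !in_itv/= ler_pdivlMr// ltr_pdivrMr//
    ltrBlDr lerBrDr mulrC.
rewrite !lebesgue_measure_itv/= !lte_fin ltr_pM2r ?invr_gt0// ltrD2r.
case: ifPn => // _; last by rewrite mule0.
by rewrite -!EFinB -EFinM; congr EFin; field; rewrite gt_eqF.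
Qed.

Lemma ge0_integral_affine (c h : R) g : 0 < c ->
  measurable_fun setT g -> (forall y, 0 <= g y)%E ->
  (\int[leb]_y g y = \int[leb]_x (g (c * x + h)%R * c%:E))%E.
Proof.
move=> c0 mg g0; have mf := measurable_affine c h.
pose nu : {measure set (measurableTypeR R) -> \bar R} :=
  image_measure leb mf.
rewrite (eq_measure_integral (mscale (NngNum (ltW c0)) nu)); last first.
  by move=> A mA _; exact: lebesgue_measure_affine.
rewrite ge0_integral_mscale// ge0_integral_pushforward// preimage_setT/=.
rewrite -ge0_integralZl//=.
- by apply: eq_integral => x _; rewrite muleC.
- exact: (measurableT_comp mg mf).
- by rewrite lee_fin ltW.
Qed.

End affine_substitution.

Section square_substitution.
Context {R : realType}.
Local Notation leb := (@lebesgue_measure R).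
Implicit Type g : measurableTypeR R -> \bar R.

(** The derivative of the square, cut off at 0 to be a nonnegative density on the whole line. *)
Let j (x : R) : R := 2 * Num.max x 0.

Let mj : measurable_fun setT j.
Proof.
by apply: measurable_funM => //; exact: (@measurable_maxr _ _ _ _ id (cst 0)).
Qed.

Let j0 x : 0 <= j x.
Proof. by rewrite /j mulr_ge0// le_max lexx orbT. Qed.

Let msqr : measurable_fun setT (fun x : measurableTypeR R => x ^+ 2 : measurableTypeR R).
Proof. exact: measurable_funX. Qed.

Let integral_j (u v : R) : 0 <= u -> u < v ->
  (\int[leb]_(x in `]u, v]) (j x)%:E = (v ^+ 2 - u ^+ 2)%:E)%E.
Proof.
move=> u0 uv.
transitivity (\int[leb]_(x in `]u, v]) (2 * x)%:E)%E.
  apply: eq_integral => x; rewrite inE/= in_itv/= => /andP[ux _].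
  by rewrite /j max_l// (le_trans u0)// ltW.
rewrite integral_itv_obnd_cbnd; last first.
  exact/measurable_EFinP/measurable_funM.
have sqc : continuous (fun x : R => x ^+ 2) by exact: exprn_continuous.
rewrite (@continuous_FTC2 _ _ (fun x => x ^+ 2))//.
- apply: continuous_subspaceT => x.
  by apply: cvgM; [exact: cvg_cst|exact: cvg_id].
- split=> [x _||]; first exact: exprn_derivable.
  + by apply: cvg_at_right_filter; exact: sqc.
  + by apply: cvg_at_left_filter; exact: sqc.
- by move=> x _; rewrite exp_derive1 expr1.
Qed.

(** Lebesgue measure on the positive half-line and the image under squaring of the measure with
    density [j] agree on half-open intervals, by the fundamental theorem of calculus, hence on all
    measurable sets. *)
Lemma ge0_integral_sqr g :
  measurable_fun setT g -> (forall y, 0 <= g y)%E ->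
  (\int[leb]_(y in `]0%R, +oo[) g y =
   \int[leb]_(x in `]0%R, +oo[) (g (x ^+ 2)%R * (2 * x)%:E))%E.
Proof.
move=> mg g0; set p : set (measurableTypeR R) := `]0%R, +oo[%classic.
have mp : measurable p by exact: measurable_itv.
have mip : measurable_fun setT (\1_p : measurableTypeR R ->
  R) by exact: measurable_indic.
have ip0 x : 0 <= (\1_p x : R) by rewrite indicE.
pose m1 : {measure set (measurableTypeR R) -> \bar R} := density leb mip ip0.
pose m2 : {measure set (measurableTypeR R) -> \bar R} :=
  image_measure (density leb mj j0) msqr.
have m1E A : measurable A -> m1 A = leb (p `&` A).
  by move=> mA; rewrite /m1/= /density integral_indic.
have m12 A : measurable A -> m1 A = m2 A.
  apply: (@measure_unique _ R (measurableTypeR R) (@ocitv R) (fun n => `](-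
    n%:R), n%:R]%classic)) => //.
  - exact: ocitvI.
  - by move=> n; exact: is_ocitv.
  - apply/seteqP; split => // x _; exists (Num.bound `|x|) => //=.
    have := archi_boundP (normr_ge0 x); rewrite ltr_norml in_itv/=.
    by move=> /andP[-> /ltW].
  - move=> _ [[u v] _ <-]; rewrite m1E /=; last exact: measurable_itv.
    rewrite /density [RHS]integral_mkcond.
    have hs (x w : R) : 0 < x -> (Num.sqrt w < x) = (w < x ^+ 2).
      move=> x0; have := ltr_sqrt w (exprn_gt0 2 x0).
      by rewrite sqrtr_sqr gtr0_norm.
    (* Up to points where [j] vanishes, this interval is the preimage of []u, v]] under squaring.
       Bounds of either sign are covered, as [Num.sqrt] is 0 on negative numbers. *)
    transitivity (\int[leb]_(x in `]Num.sqrt u, Num.sqrt v]) (j x)%:E)%E;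
      last first.
      rewrite [LHS]integral_mkcond; apply: eq_integral => x _; rewrite !patchE.
      have [x0|x0] := leP x 0.
        by rewrite /j max_r// mulr0; case: ifP; case: ifP.
      rewrite (_ : (x \in _) = (x \in (fun x => x ^+ 2) @^-1` `]u, v]))//.
      apply/idP/idP; rewrite !inE /preimage/= !in_itv/= => /andP[].
        by rewrite hs// => -> /=; rewrite !leNgt hs.
      by rewrite hs// => -> /=; rewrite !leNgt hs.
    rewrite (_ : p `&` _ = `]Num.max u 0, v]%classic); last first.
      apply/seteqP; split => x; rewrite /p/= !in_itv/= andbT gt_max.
        by move=> [-> /andP[-> ->]].
      by move=> /andP[/andP[-> ->] ->].
    rewrite lebesgue_measure_itv/= lte_fin.
    have sqrE (w : R) : Num.sqrt w ^+ 2 = Num.max w 0.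
      have [w0|w0] := leP 0 w; first by rewrite sqr_sqrtr.
      by rewrite ler0_sqrtr ?expr0n// ltW.
    have [uv|vu] := ltP (Num.sqrt u) (Num.sqrt v).
      have v0 : 0 < v by rewrite -sqrtr_gt0 (le_lt_trans _ uv)// sqrtr_ge0.
      rewrite integral_j// ?sqrtr_ge0// !sqrE (max_l (ltW v0)) gt_max v0 andbT.
      by move: uv; rewrite ltr_sqrt// => ->; rewrite EFinB.
    rewrite set_itv_ge ?integral_set0; last by rewrite bnd_simp -leNgt.
    case: ifPn => //; rewrite gt_max => /andP[uv v0].
    by move: vu; rewrite leNgt ltr_sqrt// uv.
  - move=> k; rewrite m1E; last exact: measurable_itv.
    apply: (@le_lt_trans _ _ (leb `](- k%:R), k%:R]%classic)).
      by apply: le_measure; rewrite ?inE//; apply: measurableI => //;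
        exact: measurable_itv.
    by rewrite lebesgue_measure_itv/=; case: ifP; rewrite -?EFinB ltry.
transitivity (\int[m1]_y g y)%E.
  rewrite ge0_integral_density// [LHS]integral_mkcond.
  by apply: eq_integral => x _; rewrite patchE indicE; case: ifP;
    rewrite ?mule1 ?mule0.
rewrite (eq_measure_integral m2); last by move=> A mA _; exact: m12.
rewrite /m2 ge0_integral_pushforward// preimage_setT ge0_integral_density//=;
  last first.
  exact: (measurableT_comp mg msqr).
rewrite [RHS]integral_mkcond; apply: eq_integral => x _.
rewrite patchE; case: ifPn.
  by rewrite inE /p/= in_itv/= andbT => x0; rewrite /j max_l// ltW.
rewrite notin_setE /p/= in_itv/= andbT => /negP; rewrite -leNgt /j => x0.
by rewrite max_r// mulr0 mule0.
Qed.

End square_substitution.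

(** * Triangular substitutions *)

Section lebesgue_tuple_coordinate.
Context {R : realType}.
Local Notation leb := (@lebesgue_measure R).
Local Open Scope ereal_scope.

Definition upd n (x : n.-tuple R) (k : 'I_n) (t : R) : n.-tuple R :=
  [tuple if i == k then t else tnth x i | i < n].

Lemma tnth_upd n (x : n.-tuple R) k t i :
  tnth (upd x k t) i = if i == k then t else tnth x i.
Proof. by rewrite tnth_mktuple. Qed.

Lemma measurable_upd n (x : n.-tuple R) k :
  measurable_fun setT (fun t : measurableTypeR R => upd x k t).
Proof.
apply/measurable_fun_tnthP => i.
rewrite (_ : _ \o _ = fun t => if i == k then t else tnth x i); last first.
  by apply/funext => t /=; rewrite tnth_upd.
by case: (i == k); [exact: measurable_id|exact: measurable_cst].
Qed.

Lemma ge0_integral_push_sf d1 d2 (T1 : measurableType d1)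
    (T2 : measurableType d2) (mu : {measure set T1 -> \bar R})
    (smu : sigma_finite setT mu) (f : T1 -> T2) (h : T2 -> T1)
    (mf : measurable_fun setT f) (mh : measurable_fun setT h)
    (fK : cancel f h) (g : T2 -> \bar R) :
  measurable_fun setT g -> (forall y, 0 <= g y) ->
  \int[push_sf smu mf mh fK]_y g y = \int[mu]_x g (f x).
Proof.
move=> mg g0; rewrite (eq_measure_integral (image_measure mu mf))//.
by rewrite ge0_integral_pushforward.
Qed.

Lemma ge0_integral_tuple_cons n (g : n.+1.-tuple R -> \bar R) :
  measurable_fun setT g -> (forall x, 0 <= g x) ->
  \int[lebesgue_tuple R n.+1]_x g x =
  \int[leb]_t \int[lebesgue_tuple R n]_x g [tuple of t :: x] /\
  \int[lebesgue_tuple R n.+1]_x g x =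
  \int[lebesgue_tuple R n]_x \int[leb]_t g [tuple of t :: x].
Proof.
move=> mg g0; have mgc := measurableT_comp mg (measurable_tcons (n:=n)).
have -> : \int[lebesgue_tuple R n.+1]_x g x =
    \int[leb \x lebesgue_tuple R n]_x g (tcons x).
  exact: ge0_integral_push_sf.
split.
- rewrite (fubini_tonelli1 (g \o @tcons R n))//.
  by move=> x; exact: g0.
- rewrite (fubini_tonelli2 (g \o @tcons R n))//.
  by move=> x; exact: g0.
Qed.

(** By Tonelli the head coordinate may be integrated innermost, which settles the case where [k] is
    the head, or outermost, which leaves a shorter tuple to the induction. *)
Lemma eq_integral_coordinate n (k : 'I_n) (g h : n.-tuple R -> \bar R) :
  measurable_fun setT g -> (forall x, 0 <= g x) ->
  measurable_fun setT h -> (forall x, 0 <= h x) ->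
  (forall x, \int[leb]_t g (upd x k t) = \int[leb]_t h (upd x k t)) ->
  \int[lebesgue_tuple R n]_x g x = \int[lebesgue_tuple R n]_x h x.
Proof.
elim: n => [|n IHn] in k g h *; first by case: k.
move=> mg g0 mh h0 gh.
have [g1 g2] := ge0_integral_tuple_cons mg g0.
have [h1 h2] := ge0_integral_tuple_cons mh h0.
have [k0 kk'|k'] := unliftP ord0 k; last first.
  rewrite g2 h2; apply: eq_integral => x _.
  (* The head 0 is a placeholder that [upd] overwrites. *)
  have := gh [tuple of 0%R :: x].
  have E t : upd [tuple of 0%R :: x] k t = [tuple of t :: x].
    apply: eq_from_tnth => i; rewrite tnth_upd k'.
    by have [j ->|->] := unliftP ord0 i; rewrite ?tnthS.
  by under eq_integral do rewrite E; under [RHS]eq_integral do rewrite E.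
rewrite g1 h1; apply: eq_integral => t _.
have mt : measurable_fun setT (fun x : n.-tuple R => [tuple of t :: x]).
  exact: (measurableT_comp (@measurable_tcons R n) (pair1_measurable t)).
apply: (IHn k0) => //.
- exact: (measurableT_comp mg mt).
- exact: (measurableT_comp mh mt).
move=> x; have := gh [tuple of t :: x].
have E s : upd [tuple of t :: x] k s = [tuple of t :: upd x k0 s].
  apply: eq_from_tnth => i; rewrite tnth_upd kk'.
  have [j ->|->//] := unliftP ord0 i.
  by rewrite !tnthS tnth_upd (inj_eq lift_inj).
by under eq_integral do rewrite E; under [RHS]eq_integral do rewrite E.
Qed.

End lebesgue_tuple_coordinate.

(* Coordinates are replaced one at a time, by increasing rank [r], so that each
   step is a one-dimensional substitution whose coefficients [c k] and [h k]
   are constant along the line of integration. *)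
Section triangular_substitution.
Context {R : realType}.
Variables (n : nat) (r : 'I_n -> nat) (sq : pred 'I_n).
Variables c h : 'I_n -> n.-tuple R -> R.
Hypothesis r_inj : injective r.
Hypothesis mc : forall k, measurable_fun setT (c k).
Hypothesis mh : forall k, measurable_fun setT (h k).

Definition same_below k (x y : n.-tuple R) :=
  forall l, (r l < r k)%N -> tnth x l = tnth y l.

Hypothesis c_below : forall k x y, same_below k x y -> c k x = c k y.
Hypothesis h_below : forall k x y, same_below k x y -> h k x = h k y.

Definition tri_fun k (x : n.-tuple R) :=
  if sq k then tnth x k ^+ 2 + h k x else c k x * tnth x k + h k x.

Definition tri_jac k (x : n.-tuple R) := if sq k then 2 * tnth x k else c k x.

Definition tri_subst m (x : n.-tuple R) : n.-tuple R :=
  [tuple if (r k < m)%N then tri_fun k x else tnth x k | k < n].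

(** Positivity is asked only of the square coordinates already replaced: squaring is injective
    there, and the later coefficients [c k] are positive only under this condition. *)
Definition tri_pos m (x : n.-tuple R) :=
  [forall k, (sq k && (r k < m)%N) ==> (0 < tnth x k)].

(** The Jacobian of the first [m] ranks, extended by 0 off the domain so that integrals range over
    all tuples. *)
Definition tri_weight m (x : n.-tuple R) :=
  if tri_pos m x then \prod_(k | (r k < m)%N) tri_jac k x else 0.

Hypothesis c_gt0 : forall k x, ~~ sq k -> tri_pos (r k) x -> 0 < c k x.

Let mtnth k : measurable_fun setT (fun x : n.-tuple R => tnth x k).
Proof. exact: measurable_tnth. Qed.

Lemma measurable_tri_fun k : measurable_fun setT (tri_fun k).
Proof.
rewrite /tri_fun; case: (sq k); apply: measurable_funD => //.
  exact: measurable_funX.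
exact: measurable_funM.
Qed.

Lemma measurable_tri_subst m : measurable_fun setT (tri_subst m).
Proof.
apply/measurable_fun_tnthP => k.
rewrite (_ : _ \o _ =
    fun x => if (r k < m)%N then tri_fun k x else tnth x k); last first.
  by apply/funext => t /=; rewrite tnth_mktuple.
by case: (r k < m)%N => //; exact: measurable_tri_fun.
Qed.

Lemma measurable_tri_weight m : measurable_fun setT (tri_weight m).
Proof.
apply: measurable_fun_ifT => //.
  apply: measurable_forall => k.
  by case: (_ && _) => //=; exact: measurable_fun_ltr.
under eq_fun do rewrite big_mkcond.
apply: measurable_prod => k _; case: (r k < m)%N => //.
rewrite /tri_jac; case: (sq k) => //.
exact: measurable_funM.
Qed.

Lemma tri_pos_lt m k x : (r k < m)%N -> tri_pos m x -> tri_pos (r k) x.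
Proof.
move=> km /forallP xm; apply/forallP => l; apply/implyP => /andP[sl lk].
by have := xm l; rewrite sl (ltn_trans lk km).
Qed.

Lemma tri_jac_gt0 m k x : (r k < m)%N -> tri_pos m x -> 0 < tri_jac k x.
Proof.
move=> km xm; rewrite /tri_jac; case: ifPn => sk; last first.
  by rewrite c_gt0// (tri_pos_lt km).
by move/forallP : xm => /(_ k); rewrite sk km/= => xk0; rewrite mulr_gt0.
Qed.

Lemma tri_weight_ge0 m x : 0 <= tri_weight m x.
Proof.
rewrite /tri_weight; case: ifPn => // xm.
by apply: prodr_ge0 => k km; rewrite ltW// (tri_jac_gt0 km).
Qed.

Let same_below_upd k l x t : (r l <= r k)%N -> same_below l (upd x k t) x.
Proof.
move=> lk i il; rewrite tnth_upd; case: eqP => // ik.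
by move: il; rewrite ik ltnNge lk.
Qed.

Let tri_fun_upd k l x t : (r l < r k)%N -> tri_fun l (upd x k t) = tri_fun l x.
Proof.
move=> lk; have s := same_below_upd x t (ltnW lk).
rewrite /tri_fun (c_below s) (h_below s) tnth_upd.
by case: eqP lk => [->|//]; rewrite ltnn.
Qed.

Let tri_jac_upd k l x t : (r l < r k)%N -> tri_jac l (upd x k t) = tri_jac l x.
Proof.
move=> lk; have s := same_below_upd x t (ltnW lk).
rewrite /tri_jac (c_below s) tnth_upd.
by case: eqP lk => [->|//]; rewrite ltnn.
Qed.

Let tri_pos_upd k x t : tri_pos (r k) (upd x k t) = tri_pos (r k) x.
Proof.
apply: eq_forallb => l; case: (boolP (r l < r k)%N) => lk; rewrite ?andbF//.
by rewrite tnth_upd; case: eqP lk => [->|//]; rewrite ltnn.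
Qed.

Let tri_weight_upd k x t : tri_weight (r k) (upd x k t) = tri_weight (r k) x.
Proof.
rewrite /tri_weight tri_pos_upd; case: ifP => // _.
by apply: eq_bigr => l lk; rewrite tri_jac_upd.
Qed.

Let tri_subst_upd k x t :
  tri_subst (r k) (upd x k t) = upd (tri_subst (r k) x) k t.
Proof.
apply: eq_from_tnth => l; rewrite tnth_mktuple !tnth_upd tnth_mktuple.
case: ifPn => [lk|_//]; rewrite tri_fun_upd//.
by case: eqP lk => [->|//]; rewrite ltnn.
Qed.

Let tri_substS k x : tri_subst (r k).+1 x =
  upd (tri_subst (r k) x) k (tri_fun k x).
Proof.
apply: eq_from_tnth => l; rewrite tnth_mktuple tnth_upd tnth_mktuple.
rewrite ltnS leq_eqVlt; case: eqP => [/r_inj ->|/eqP rlk];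
  first by rewrite eqxx.
by case: (eqVneq l k) rlk => [->|//]; rewrite eqxx.
Qed.

Let tri_weightS k x : tri_weight (r k).+1 x =
  if ~~ sq k || (0 < tnth x k) then tri_weight (r k) x * tri_jac k x else 0.
Proof.
rewrite /tri_weight.
have -> : tri_pos (r k).+1 x = tri_pos (r k) x && (~~ sq k || (0 < tnth x k)).
  apply/forallP/andP => [xk|[/forallP xk xk0] l].
    split; last by have := xk k; rewrite ltnSn andbT implybE.
    apply/forallP => l; apply/implyP => /andP[sl lk].
    by have := xk l; rewrite sl ltnS ltnW.
  apply/implyP => /andP[sl]; rewrite ltnS leq_eqVlt => /orP[/eqP/r_inj lk|lk].
    by move: xk0; rewrite -lk sl.
  by have := xk l; rewrite sl lk.
case: (tri_pos _ _) => /=; last by rewrite mul0r if_same.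
case: ifP => // _; rewrite (bigD1 k) ?ltnSn//= mulrC; congr (_ * _).
apply: eq_bigl => l; rewrite ltnS leq_eqVlt.
case: (eqVneq l k) => [->|lk]; rewrite ?eqxx ?ltnn//= ?andbT ?andbF//.
by rewrite (inj_eq r_inj) (negPf lk).
Qed.

Local Open Scope ereal_scope.
Variable f : n.-tuple R -> \bar R.
Hypotheses (mf : measurable_fun setT f) (f0 : forall y, 0 <= f y).
(* A coordinate replaced by a square plus [h] only reaches the values above [h];
   [f] has to vanish elsewhere. *)
Hypothesis f_supp : forall k x, sq k -> tri_pos (r k) x ->
  f (tri_subst (r k) x) != 0 -> (h k x < tnth x k)%R.

Let F m x := f (tri_subst m x) * (tri_weight m x)%:E.

Let mF m : measurable_fun setT (F m).
Proof.
apply: emeasurable_funM; first exact: (measurableT_comp mf (measurable_tri_subst m)).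
by apply/measurable_EFinP; exact: measurable_tri_weight.
Qed.

Let F_ge0 m x : 0 <= F m x.
Proof. by rewrite mule_ge0// lee_fin tri_weight_ge0. Qed.

(** If [r k = m], then [F m] and [F m.+1] differ, along each line in direction [k], by a
    substitution in one real variable. A rank that is not attained changes nothing. *)
Let integral_tri_step m :
  \int[lebesgue_tuple R n]_x F m x = \int[lebesgue_tuple R n]_x F m.+1 x.
Proof.
have [/existsP[k /eqP rk]|] := boolP [exists k, r k == m]; last first.
  move=> /existsPn mr; apply: eq_integral => x _.
  have E l : (r l < m.+1)%N = (r l < m)%N
    by rewrite ltnS leq_eqVlt (negPf (mr l)).
  rewrite /F (_ : tri_subst m.+1 x = tri_subst m x); last first.
    by apply: eq_from_tnth => l; rewrite !tnth_mktuple E.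
  rewrite /tri_weight.
  have -> : tri_pos m.+1 x = tri_pos m x.
    by rewrite /tri_pos; apply: eq_forallb => l; rewrite E.
  by under [in RHS]eq_bigl do rewrite E.
rewrite -{m}rk; apply: (eq_integral_coordinate (k := k)) => // x.
have mu := measurable_upd (tri_subst (r k) x) k.
(* If an earlier square coordinate is not positive, the weight kills both integrands along the whole
   line. *)
have [xk|xk] := boolP (tri_pos (r k) x); last first.
  have w0 t : tri_weight (r k) (upd x k t) = 0%R.
    by rewrite tri_weight_upd /tri_weight (negPf xk).
  rewrite !integral0_eq// => t _;
    rewrite /F ?tri_weightS w0 ?mul0r ?if_same mule0//.
pose w := tri_weight (r k) x; pose hk := h k x.
pose G t := f (upd (tri_subst (r k) x) k t) * w%:E.
have mG : measurable_fun setT (G : measurableTypeR R -> \bar R).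
  apply: emeasurable_funM; last exact: measurable_cst.
  exact: (measurableT_comp mf mu).
have G0 t : 0 <= G t by rewrite mule_ge0// lee_fin tri_weight_ge0.
have FE t : F (r k) (upd x k t) = G t.
  by rewrite /F tri_subst_upd tri_weight_upd.
have sk t : same_below k (upd x k t) x by exact: same_below_upd.
have FSE t : F (r k).+1 (upd x k t) =
    if sq k then if (0 < t)%R then G (t ^+ 2 + hk)%R * (2 * t)%:E else 0
    else G (c k x * t + hk)%R * (c k x)%:E.
  rewrite /F tri_substS tri_weightS tri_subst_upd tri_weight_upd /tri_jac /tri_fun.
  rewrite (c_below (sk t)) (h_below (sk t)) tnth_upd eqxx -/w -/hk /G.
  have updd y s u : upd (upd y k s) k u = upd y k u.
    by apply: eq_from_tnth => i; rewrite !tnth_upd; case: (i == k).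
  rewrite updd; case: (sq k) => /=; last by rewrite EFinM muleA.
  by case: ifP => _; rewrite ?mule0// EFinM muleA.
under eq_integral do rewrite FE.
under [RHS]eq_integral do rewrite FSE.
have [sqk|nsqk] := boolP (sq k); last first.
  by rewrite -(@ge0_integral_affine R _ hk G)// c_gt0.
(* By [f_supp] nothing is lost below [hk]: after a shift by [hk] only the positive half-line
   remains, and squaring covers it. *)
have Gh t : (t <= hk)%R -> G t = 0.
  move=> th; rewrite /G; apply/eqP; apply: contraTT th => Gt.
  have := @f_supp k (upd x k t) sqk.
  rewrite tri_pos_upd tri_subst_upd tnth_upd eqxx (h_below (sk t)) -ltNge;
    apply=> //.
  by apply: contra Gt => /eqP ->; rewrite mul0e.
rewrite (@ge0_integral_affine R 1 hk G)//.
transitivity (\int[lebesgue_measure]_(t in `]0%R, +oo[) G (t + hk)%R).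
  rewrite [RHS]integral_mkcond; apply: eq_integral => t _.
  rewrite mule1 mul1r patchE; case: ifPn => //.
  rewrite notin_setE/= in_itv/= andbT => /negP; rewrite -leNgt => t0.
  by rewrite Gh// gerDr.
have mGh : measurable_fun setT ((fun t => G (t + hk)%R) : measurableTypeR R ->
  \bar R).
  by apply: (measurableT_comp mG); exact: measurable_funD.
rewrite (ge0_integral_sqr mGh)// [LHS]integral_mkcond.
apply: eq_integral => t _; rewrite patchE.
by rewrite (_ : (t \in _) = (0 < t)%R)// mem_setE in_itv/= andbT.
Qed.

Lemma ge0_integral_tri_subst :
  \int[lebesgue_tuple R n]_y f y =
  \int[lebesgue_tuple R n]_x (f [tuple tri_fun k x | k < n] *
    (if [forall k, sq k ==> (0 < tnth x k)%R] then \prod_k tri_jac k x else 0)%:E).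
Proof.
pose M := (\max_k r k).+1.
have kM k : (r k < M)%N by rewrite ltnS leq_bigmax.
transitivity (\int[lebesgue_tuple R n]_x F 0 x).
  apply: eq_integral => x _; rewrite /F /tri_weight.
  rewrite ifT; last by apply/forallP => k; rewrite andbF.
  rewrite big_pred0// mule1; congr f; apply: eq_from_tnth => k.
  by rewrite tnth_mktuple.
transitivity (\int[lebesgue_tuple R n]_x F M x).
  by elim: M {kM} => // m ->; exact: integral_tri_step.
apply: eq_integral => x _; rewrite /F /tri_weight; congr (f _ * _%:E).
  by apply: eq_from_tnth => k; rewrite !tnth_mktuple kM.
rewrite (eq_bigl xpredT) => [|k]; last by rewrite kM.
rewrite (_ : tri_pos M x = [forall k, sq k ==> (0 < tnth x k)%R])//.
by rewrite /tri_pos; apply: eq_forallb => k; rewrite kM andbT.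
Qed.

End triangular_substitution.

(** * Cholesky decomposition *)

Section cholesky.
Variable R : realType.

(** The Cholesky recursion. Given the entries that precede [(k, l)] row by row, the value is affine
    in [X k l] with slope [X l l] if [l < k], and a square plus a constant if [l = k]. *)
Lemma trig_gramE p (X : 'M[R]_p) (k l : 'I_p) : is_trig_mx X ->
  (X *m X^T) k l = X k l * X l l + \sum_(q < p | (q < l)%N) X k q * X l q.
Proof.
move=> /is_trig_mxP X0; rewrite mxE (bigD1 l)//= mxE; congr (_ + _).
rewrite big_mkcond [RHS]big_mkcond; apply: eq_bigr => q _;
  rewrite mxE -val_eqE/=.
by case: ltngtP => // lq; rewrite (X0 l q) ?mulr0.
Qed.

Definition lex p (i j : 'I_p) := (i * p + j)%N.

Lemma ltn_lex p (i j k l : 'I_p) :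
  (lex i j < lex k l)%N = (i < k)%N || ((i == k) && (j < l)%N).
Proof.
rewrite /lex -val_eqE/=; case: (ltngtP i k) => [ik|ki|->] /=.
- have : (i.+1 * p <= k * p)%N by rewrite leq_mul2r ik orbT.
  rewrite mulSn; have := ltn_ord j; lia.
- have : (k.+1 * p <= i * p)%N by rewrite leq_mul2r ki orbT.
  rewrite mulSn; have := ltn_ord l; lia.
- by rewrite ltn_add2l.
Qed.

(* The Cholesky recursion determines the factor entry by entry, row by row. *)
Lemma gram_prefix_inj p (X Y : 'M[R]_p) m : is_trig_mx X -> is_trig_mx Y ->
  (forall i, (lex i i < m)%N -> 0 < X i i) ->
  (forall i, (lex i i < m)%N -> 0 < Y i i) ->
  (forall k l : 'I_p, (l <= k)%N -> (lex k l < m)%N ->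
     (X *m X^T) k l = (Y *m Y^T) k l) ->
  forall k l : 'I_p, (l <= k)%N -> (lex k l < m)%N -> X k l = Y k l.
Proof.
move=> tX tY X0 Y0 XY k l.
have [s] := ubnP (lex k l); elim: s => // s IHs in k l *.
rewrite ltnS => kls lk klm; have := XY k l lk klm.
rewrite !trig_gramE//.
have lt_kl i j : (lex i j < lex k l)%N -> (j <= i)%N -> X i j = Y i j.
  by move=> ijkl ji; apply: IHs => //;
    [exact: leq_trans kls|exact: ltn_trans klm].
have -> : \sum_(q < p | (q < l)%N) X k q * X l q =
    \sum_(q < p | (q < l)%N) Y k q * Y l q.
  apply: eq_bigr => q ql; rewrite !lt_kl//.
  - by rewrite ltn_lex -val_eqE/= ql andbT orbC -leq_eqVlt.
  - exact: ltnW.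
  - by rewrite ltn_lex eqxx ql orbT.
  - by rewrite (leq_trans (ltnW ql)).
(* Off the diagonal, divide by the diagonal entry of row [l], already known to be common; on it, two
   positive numbers have equal squares. *)
move=> /addIr; case: (ltngtP l k) lk => // [lk|/val_inj lk] _.
  have llkl : (lex l l < lex k l)%N by rewrite ltn_lex lk.
  rewrite (lt_kl l l)//; apply: mulIf.
  by rewrite gt_eqF// Y0// (ltn_trans llkl).
move: klm; rewrite lk -!expr2 => kkm /eqP.
by rewrite eqrXn2 ?ltW ?X0 ?Y0// => /eqP.
Qed.

Lemma gram_inj p (X Y : 'M[R]_p) : LT p X -> LT p Y ->
  X *m X^T = Y *m Y^T -> X = Y.
Proof.
move=> [tX X0] [tY Y0] XY; apply/matrixP => k l.
have [lk|kl] := leqP l k.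
  by apply: (@gram_prefix_inj _ _ _ (lex k l).+1) => // i j _ _; rewrite XY.
by rewrite (is_trig_mxP tX)// (is_trig_mxP tY).
Qed.

Lemma LT_det p (X : 'M[R]_p) : LT p X -> \det X = \prod_i X i i.
Proof. by move=> [tX _]; rewrite det_trig. Qed.

Lemma LT_unit p (X : 'M[R]_p) : LT p X -> X \in unitmx.
Proof.
move=> XT; rewrite unitmxE unitfE LT_det// gt_eqF// prodr_gt0// => i _.
exact: XT.2.
Qed.

Lemma mulmx_trig p (X Y : 'M[R]_p) :
  is_trig_mx X -> is_trig_mx Y -> is_trig_mx (X *m Y).
Proof.
move=> /is_trig_mxP tX /is_trig_mxP tY.
apply/is_trig_mxP => i j ij; rewrite mxE big1// => k _.
have [ik|ki] := ltnP i k; first by rewrite tX ?mul0r.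
by rewrite tY ?mulr0// (leq_ltn_trans ki).
Qed.

Lemma LT_mul p (X Y : 'M[R]_p) : LT p X -> LT p Y -> LT p (X *m Y).
Proof.
move=> [tX X0] [tY Y0]; split; first exact: mulmx_trig.
move/is_trig_mxP : tX => tX; move/is_trig_mxP : tY => tY.
move=> i; rewrite mxE (bigD1 i)//= big1 ?addr0 ?mulr_gt0// => k ki.
case: (ltngtP k i) => [ki'|ik|/val_inj/eqP]; last by rewrite (negPf ki).
  by rewrite tY ?mulr0.
by rewrite tX ?mul0r.
Qed.

Lemma PD_sym p (A : 'M[R]_p) : PD p A -> A^T = A. Proof. by case. Qed.

Lemma PD_congr p (T A : 'M[R]_p) : T \in unitmx -> PD p A ->
  PD p (T *m A *m T^T).
Proof.
move=> uT [sA A0]; split; first by rewrite !trmx_mul trmxK sA mulmxA.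
move=> v v0; have := A0 (v *m T); rewrite trmx_mul !mulmxA; apply.
by apply: contra v0 => /eqP vT; rewrite -(mulmxK uT v) vT mul0mx.
Qed.

Lemma PD1 p : PD p (1%:M : 'M[R]_p).
Proof.
split=> [|v v0]; first exact: trmx1.
rewrite mulmx1 mxE; under eq_bigr do rewrite mxE -expr2.
rewrite lt_neqAle sumr_ge0 ?andbT; last by move=> i _; exact: sqr_ge0.
rewrite eq_sym; apply: contra v0 => /eqP /psumr_eq0P v2.
apply/eqP/rowP => i; rewrite mxE; apply/eqP; rewrite -sqrf_eq0 v2//.
by move=> j _; exact: sqr_ge0.
Qed.

Lemma PD_add p (A B : 'M[R]_p) : PD p A -> PD p B -> PD p (A + B).
Proof.
move=> [sA A0] [sB B0]; split=> [|v v0]; first by rewrite linearD/= sA sB.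
by rewrite mulmxDr mulmxDl mxE addr_gt0 ?A0 ?B0.
Qed.

Definition schur p (A : 'M[R]_(1 + p)) : 'M[R]_p :=
  drsubmx A - (A 0 0)^-1 *: (dlsubmx A *m (dlsubmx A)^T).

(** Completing the square in the first coordinate. *)
Lemma quad_schur p (A : 'M[R]_(1 + p)) x (w : 'rV[R]_p) :
  A^T = A -> A 0 0 != 0 ->
  let s := (w *m dlsubmx A) 0 0 in
  (row_mx x%:M w *m A *m (row_mx x%:M w)^T) 0 0 =
  A 0 0 * (x + s / A 0 0) ^+ 2 + (w *m schur A *m w^T) 0 0.
Proof.
move=> sA a0 s.
have ul : ulsubmx A = (A 0 0)%:M.
  by apply/matrixP => i j; rewrite !mxE !ord1 eqxx; congr (A _ _);
    apply/val_inj.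
have ur : ursubmx A = (dlsubmx A)^T by rewrite trmx_dlsub sA.
rewrite -[A in LHS]submxK mul_row_block tr_row_mx mul_row_col ul ur.
have ws : w *m dlsubmx A = s%:M by rewrite [LHS]mx11_scalar.
have ws' : (dlsubmx A)^T *m w^T = s%:M by rewrite -trmx_mul ws tr_scalar_mx.
have -> : w *m schur A *m w^T =
  w *m drsubmx A *m w^T - ((A 0 0)^-1 * (s * s))%:M.
  rewrite /schur mulmxBr mulmxBl -scalemxAr -scalemxAl (mulmxA w) ws.
  by rewrite -(mulmxA s%:M) ws' -scalar_mxM scale_scalar_mx.
rewrite !mulmxDl ws -(mulmxA x%:M (dlsubmx A)^T) ws' tr_scalar_mx -!scalar_mxM
  !mxE !eqxx !mulr1n.
by field.
Qed.

(** Minimizing the quadratic form over the first coordinate leaves the form of the Schur complement.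
    The criterion drives both the Cholesky recursion and the measurability of [PD]. *)
Lemma PD_schur p (A : 'M[R]_(1 + p)) :
  PD (1 + p) A <-> [/\ A^T = A, 0 < A 0 0 & PD p (schur A)].
Proof.
split=> [[sA A0]|[sA a0 [_ S0]]].
  have a0 : 0 < A 0 0.
    have := A0 (delta_mx 0 0); rewrite trmx_delta -rowE -colE !mxE; apply.
    by apply/eqP => /matrixP/(_ 0 0)/eqP; rewrite !mxE !eqxx oner_eq0.
  split=> //; split.
    by rewrite linearB/= linearZ/= trmx_mul trmxK trmx_drsub sA.
  move=> w w0; pose s := (w *m dlsubmx A) 0 0.
  (* This first coordinate annihilates the completed square. *)
  have := A0 (row_mx (- (s / A 0 0))%:M w).
  rewrite quad_schur ?gt_eqF// addNr expr0n/= mulr0 add0r; apply.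
  by apply: contra w0; rewrite -row_mx0 => /eqP/eq_row_mx[_ ->].
split=> // v; have -> : v = row_mx (v 0 0)%:M (rsubmx v).
  rewrite -[LHS]hsubmxK; congr row_mx; apply/rowP => i.
  by rewrite !mxE !ord1 eqxx; congr (v _ _); apply/val_inj.
move: (v 0 0) (rsubmx v) => {v} x w v0.
rewrite quad_schur ?gt_eqF//.
have [w0|w0] := eqVneq w 0; last first.
  by rewrite ltr_wpDl ?S0// mulr_ge0 ?sqr_ge0// ltW.
rewrite w0 !mul0mx !mxE mul0r addr0 addr0 mulr_gt0// exprn_even_gt0//=.
by apply: contra v0 => /eqP ->; rewrite w0 raddf0 row_mx0.
Qed.

Lemma LT_block p (t : R) (v : 'cV[R]_p) (L : 'M[R]_p) :
  0 < t -> LT p L -> LT (1 + p) (block_mx t%:M 0 v L).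
Proof.
move=> t0 [tL L0]; split=> [|i].
  by rewrite is_trig_block_mx// eqxx tL andbT mx11_is_trig.
rewrite -[i]splitK; case: (fintype.split i) => k /=.
  by rewrite block_mxEul mxE eqxx.
by rewrite block_mxEdr.
Qed.

Lemma block_gram p (A : 'M[R]_(1 + p)) (L : 'M[R]_p) :
  A^T = A -> 0 < A 0 0 -> L *m L^T = schur A ->
  let T : 'M[R]_(1 + p) := block_mx (Num.sqrt (A 0 0))%:M 0
    ((Num.sqrt (A 0 0))^-1 *: dlsubmx A) L in
  T *m T^T = A.
Proof.
move=> sA a0 LL T; have t0 : 0 < Num.sqrt (A 0 0) by rewrite sqrtr_gt0.
rewrite /T tr_block_mx mulmx_block !tr_scalar_mx trmx0 !mul0mx !mulmx0 !addr0.
rewrite LL -!scalar_mxM -expr2 sqr_sqrtr ?ltW// linearZ/= !mul_scalar_mx !mul_mx_scalar.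
rewrite !scalerA mulfV ?gt_eqF// !scale1r -scalemxAl -scalemxAr scalerA.
rewrite -invfM -expr2 sqr_sqrtr ?ltW// /schur addrC subrK.
rewrite -[RHS]submxK; congr block_mx.
  by apply/matrixP => i j; rewrite !mxE !ord1 eqxx; congr (A _ _);
    apply/val_inj.
by rewrite trmx_dlsub sA.
Qed.

(** Unlike the choice in [T_of], an explicit formula built from measurable operations. *)
Fixpoint chol p : 'M[R]_p -> 'M[R]_p :=
  match p with
  | 0 => id
  | p.+1 => fun A : 'M[R]_(1 + p) =>
      block_mx (Num.sqrt (A 0 0))%:M 0
        ((Num.sqrt (A 0 0))^-1 *: dlsubmx A) (chol (schur A))
  end.

Lemma chol_gram p (A : 'M[R]_p) : PD p A ->
  LT p (chol A) /\ chol A *m (chol A)^T = A.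
Proof.
elim: p A => [|p IHp] A; first by split; [split=> [|[]//];
  apply/is_trig_mxP=> -[]|apply/matrixP => -[]].
move=> /(@PD_schur p)[sA a0 /IHp[[tL L0] LL]].
have t0 : 0 < Num.sqrt (A 0 0) by rewrite sqrtr_gt0.
split; first exact: (@LT_block p).
exact: (@block_gram p).
Qed.

End cholesky.

(** * Measurability of matrix operations and of the Cholesky factor *)

Section measurable_matrix_operations.
Context d (X : measurableType d) (R : realType).

Lemma measurable_set_bool (b : X -> bool) :
  measurable_fun setT b -> measurable [set x | b x].
Proof.
move=> /(_ measurableT [set true]); rewrite setTI.
by rewrite (_ : b @^-1` [set true] = [set x | b x])//; apply.
Qed.

Lemma measurable_funV (f : X -> R) :
  measurable_fun setT f -> measurable_fun setT (fun x => (f x)^-1).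
Proof.
(* The square brings the inverse down to a power of a nonnegative number. At 0 both sides are 0. *)
move=> mf; rewrite (_ : (fun _ => _) = fun x => f x * (f x ^+ 2) `^ (- 1)).
  apply: measurable_funM => //.
  by apply: (measurableT_comp (measurable_powR (- 1))); exact: measurable_funX.
apply/funext => x; rewrite powR_inv1 ?sqr_ge0//.
have [->|fx0] := eqVneq (f x) 0; first by rewrite invr0 mul0r.
by rewrite expr2 invfM mulrA mulfV// mul1r.
Qed.

Lemma measurable_fun_sqrt (f : X -> R) :
  measurable_fun setT f -> measurable_fun setT (fun x => Num.sqrt (f x)).
Proof.
move=> mf; apply: (measurableT_comp _ mf).
exact: (continuous_measurable_fun (@sqrt_continuous R)).
Qed.

Lemma measurable_fun_entry m n (f : X -> 'M[R]_(m, n)) i j :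
  measurable_fun setT f -> measurable_fun setT (fun x => f x i j).
Proof. by move=> mf; exact: (measurableT_comp (measurable_entry i j) mf). Qed.

Lemma measurable_trmx m n (f : X -> 'M[R]_(m, n)) :
  measurable_fun setT f -> measurable_fun setT (fun x => (f x)^T).
Proof.
move=> mf; apply: measurable_fun_mxP => i j.
by under eq_fun do rewrite mxE; exact: measurable_fun_entry.
Qed.

Lemma measurable_addmx m n (f g : X -> 'M[R]_(m, n)) :
  measurable_fun setT f -> measurable_fun setT g ->
  measurable_fun setT (fun x => f x + g x).
Proof.
move=> mf mg; apply: measurable_fun_mxP => i j.
under eq_fun do rewrite mxE.
by apply: measurable_funD; exact: measurable_fun_entry.
Qed.

Lemma measurable_oppmx m n (f : X -> 'M[R]_(m, n)) :
  measurable_fun setT f -> measurable_fun setT (fun x => - f x).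
Proof.
move=> mf; apply: measurable_fun_mxP => i j.
under eq_fun do rewrite mxE.
by apply: measurableT_comp => //; exact: measurable_fun_entry.
Qed.

Lemma measurable_scalemx m n (c : X -> R) (f : X -> 'M[R]_(m, n)) :
  measurable_fun setT c -> measurable_fun setT f ->
  measurable_fun setT (fun x => c x *: f x).
Proof.
move=> mc mf; apply: measurable_fun_mxP => i j.
under eq_fun do rewrite mxE.
by apply: measurable_funM => //; exact: measurable_fun_entry.
Qed.

Lemma measurable_mulmx m n p (f : X -> 'M[R]_(m, n)) (g : X -> 'M[R]_(n, p)) :
  measurable_fun setT f -> measurable_fun setT g ->
  measurable_fun setT (fun x => f x *m g x).
Proof.
move=> mf mg; apply: measurable_fun_mxP => i j.
under eq_fun do rewrite mxE.
apply: measurable_sum => k.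
by apply: measurable_funM; exact: measurable_fun_entry.
Qed.

Lemma measurable_det n (f : X -> 'M[R]_n) :
  measurable_fun setT f -> measurable_fun setT (fun x => \det (f x)).
Proof.
move=> mf; apply: measurable_sum => s; apply: measurable_funM => //.
by apply: measurable_prod => i _; exact: measurable_fun_entry.
Qed.

Lemma measurable_invmx n (f : X -> 'M[R]_n) :
  measurable_fun setT f -> measurable_fun setT (fun x => invmx (f x)).
Proof.
(* [invmx] is the adjugate over the determinant on invertible matrices and the identity map
   elsewhere. *)
move=> mf; apply: measurable_fun_ifT => //.
  under eq_fun do rewrite unitmxE unitfE.
  apply: measurable_neg; apply: measurable_fun_eqr => //.
  exact: measurable_det.
apply: measurable_scalemx; first by apply: measurable_funV;
  exact: measurable_det.
apply: measurable_fun_mxP => i j; under eq_fun do rewrite mxE.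
apply: measurable_funM => //; apply: measurable_det.
apply: measurable_fun_mxP => k l; under eq_fun do rewrite !mxE.
exact: measurable_fun_entry.
Qed.

Lemma measurable_eq_mx m n (f g : X -> 'M[R]_(m, n)) :
  measurable_fun setT f -> measurable_fun setT g ->
  measurable [set x | f x = g x].
Proof.
move=> mf mg; rewrite (_ : [set _ | _] =
    [set x | [forall i, [forall j, f x i j == g x i j]]]); last first.
  apply/seteqP; split => x /=.
    by move=> fg; apply/forallP => i; apply/forallP => j; rewrite fg.
  move=> /forallP fg.
  by apply/matrixP => i j; apply/eqP; move: (fg i) => /forallP.
apply: measurable_set_bool; do 2 apply: measurable_forall => ?.
by apply: measurable_fun_eqr; exact: measurable_fun_entry.
Qed.

Lemma measurable_block_mx m1 m2 n1 n2 (a : X -> 'M[R]_(m1, n1))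
    (b : X -> 'M[R]_(m1, n2)) (c : X -> 'M[R]_(m2, n1)) (e : X ->
      'M[R]_(m2, n2)) :
  measurable_fun setT a -> measurable_fun setT b ->
  measurable_fun setT c -> measurable_fun setT e ->
  measurable_fun setT (fun x => block_mx (a x) (b x) (c x) (e x)).
Proof.
move=> ma mb mc me; apply: measurable_fun_mxP => i j.
rewrite -[i]splitK -[j]splitK; case: (fintype.split i) => k;
  case: (fintype.split j) => l /=;
  under eq_fun do rewrite ?block_mxEul ?block_mxEur ?block_mxEdl ?block_mxEdr;
  exact: measurable_fun_entry.
Qed.

End measurable_matrix_operations.

Section measurable_cholesky.
Variable R : realType.

Lemma measurable_dlsubmx m1 m2 n1 n2 :
  measurable_fun setT (@dlsubmx R m1 m2 n1 n2).
Proof.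
apply: measurable_fun_mxP => i j; under eq_fun do rewrite !mxE.
exact: measurable_entry.
Qed.

Lemma measurable_drsubmx m1 m2 n1 n2 :
  measurable_fun setT (@drsubmx R m1 m2 n1 n2).
Proof.
apply: measurable_fun_mxP => i j; under eq_fun do rewrite !mxE.
exact: measurable_entry.
Qed.

Lemma measurable_schur p : measurable_fun setT (@schur R p).
Proof.
apply: measurable_addmx; first exact: measurable_drsubmx.
apply: measurable_oppmx; apply: measurable_scalemx.
  by apply: measurable_funV; exact: measurable_entry.
have mdl := @measurable_dlsubmx 1 p 1 p.
by apply: measurable_mulmx => //; exact: measurable_trmx.
Qed.

Lemma measurable_chol p : measurable_fun setT (@chol R p).
Proof.
elim: p => [|p IHp] /=; first exact: measurable_id.
have ms : measurable_fun setT (fun A : 'M[R]_(1 + p) => Num.sqrt (A 0 0)).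
  by apply: measurable_fun_sqrt; exact: measurable_entry.
apply: (@measurable_block_mx _ _ _ 1 p 1 p) => //.
- apply: measurable_fun_mxP => i j; under eq_fun do rewrite mxE.
  by case: (i == j); [exact: ms|exact: measurable_cst].
- apply: measurable_scalemx; first exact: measurable_funV.
  exact: (@measurable_dlsubmx 1 p 1 p).
- exact: (measurableT_comp IHp (measurable_schur (p := p))).
Qed.

(** [PD] is defined by uncountably many inequalities; the Schur criterion leaves one equation and
    one inequality per dimension. *)
Lemma measurable_PD p : measurable (PD p : set 'M[R]_p).
Proof.
elim: p => [|p IHp].
  rewrite (_ : PD 0 = setT)//; apply/seteqP; split => // A _.
  by split=> [|v]; [apply/matrixP => -[]|rewrite thinmx0 eqxx].
rewrite (_ : PD p.+1 = [set A : 'M[R]_(1 + p) | A^T = A] `&`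
    [set A : 'M[R]_(1 + p) | 0 < A 0 0] `&` (@schur R p @^-1` PD p)).
  apply: measurableI; first apply: measurableI.
  - by apply: measurable_eq_mx => //; exact: measurable_trmx.
  - apply: measurable_set_bool; apply: measurable_fun_ltr => //.
    exact: measurable_entry.
  - by rewrite -[X in measurable X]setTI; exact: measurable_schur.
apply/seteqP; split => A.
  by move=> /(@PD_schur R p)[].
by move=> [[? ?] ?]; apply/(@PD_schur R p).
Qed.

Lemma measurable_LT p : measurable (LT p : set 'M[R]_p).
Proof.
rewrite (_ : LT p = [set G : 'M[R]_p |
    [forall i : 'I_p, [forall j : 'I_p, ((i < j)%N ==> (G i j == 0)) && (0 < G i i)]]]).
  apply: measurable_set_bool; do 2 apply: measurable_forall => ?.
  apply: measurable_and; last by apply: measurable_fun_ltr => //;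
    exact: measurable_entry.
  case: (_ < _)%N => //=.
  by apply: measurable_fun_eqr => //; exact: measurable_entry.
apply/seteqP; split => G /=.
  move=> [/is_trig_mxP tG G0]; apply/forallP => i; apply/forallP => j.
  by rewrite G0 andbT; apply/implyP => ij; rewrite tG.
move=> /forallP G0; split=> [|i]; last by move: (G0 i) => /forallP/(_ i)/andP[].
by apply/is_trig_mxP => i j ij; move: (G0 i) => /forallP/(_ j);
  rewrite ij => /andP[/eqP].
Qed.

Lemma measurable_PD_unit p : measurable (PD_unit p : set 'M[R]_p).
Proof.
rewrite (_ : PD_unit p = PD p `&` ((fun U => 1%:M - U) @^-1` PD p)).
  apply: measurableI; first exact: measurable_PD.
  rewrite -[X in measurable X]setTI; apply: measurable_addmx => //.
  - exact: measurable_oppmx.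
  - exact: measurable_PD.
by apply/seteqP; split => U; rewrite /PD_unit /mx_lt /= subr0.
Qed.

Lemma T_of_chol p (W : 'M[R]_p * 'M[R]_p) : PD p (W.1 + W.2) ->
  T_of W = chol (W.1 + W.2).
Proof.
move=> WP; have [cL cW] := chol_gram WP.
by apply: xget_unique => // T [TL TW]; apply: gram_inj => //; rewrite TW cW.
Qed.

Lemma T_ofE p (T : 'M[R]_p) (W : 'M[R]_p * 'M[R]_p) : LT p T ->
  T *m T^T = W.1 + W.2 -> T_of W = T.
Proof.
by move=> TL TW; apply: xget_unique => // T' [TL' TW']; apply: gram_inj => //;
  rewrite TW TW'.
Qed.

End measurable_cholesky.

(** * Jacobians of matrix maps *)

Section triangular_indices.
Variable p : nat.

Definition tri_row (k : 'I_#|{: tri p}|) : 'I_p := (val (enum_val k)).1.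
Definition tri_col (k : 'I_#|{: tri p}|) : 'I_p := (val (enum_val k)).2.

Lemma tri_col_le k : (tri_col k <= tri_row k)%N.
Proof. exact: valP (enum_val k). Qed.

Lemma tri_inj k l : tri_row k = tri_row l -> tri_col k = tri_col l -> k = l.
Proof.
rewrite /tri_row /tri_col => r c; apply/enum_val_inj/val_inj.
by rewrite [LHS]surjective_pairing [RHS]surjective_pairing r c.
Qed.

Lemma tri_index (i j : 'I_p) : (j <= i)%N ->
  exists k, tri_row k = i /\ tri_col k = j.
Proof.
move=> ji; exists (enum_rank (exist _ (i, j) ji : tri p)).
by rewrite /tri_row /tri_col enum_rankK.
Qed.

Lemma lex_inj (i j k l : 'I_p) : lex i j = lex k l -> i = k /\ j = l.
Proof.
move=> E; have := ltn_lex i j k l; have := ltn_lex k l i j; rewrite E ltnn.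
rewrite -!val_eqE/= ; case: ltngtP => //= /val_inj <-.
by case: ltngtP => //= /val_inj <-.
Qed.

Lemma prod_tri (R : comPzSemiRingType) (F : 'I_p -> 'I_p -> R) :
  \prod_k F (tri_row k) (tri_col k) =
    \prod_(i < p) \prod_(j < p | (j <= i)%N) F i j.
Proof.
rewrite pair_big_dep/=.
rewrite (reindex_omap val (insub : _ -> option (tri p)))/=; last first.
  by move=> [i j] ij; rewrite insubT.
rewrite (eq_bigl (fun k => k \in {: tri p})); last first.
  by move=> k; rewrite valK eqxx andbT (valP k).
by rewrite [RHS]big_enum_val.
Qed.

Lemma card_ord_ge (j : 'I_p) : #|[pred i : 'I_p | (j <= i)%N]| = (p - j)%N.
Proof.
rewrite -sum1_card -(big_geq_mkord j p xpredT (fun=> 1%N)) sum_nat_const_nat.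
by rewrite muln1.
Qed.

Lemma card_ord_le (i : 'I_p) : #|[pred j : 'I_p | (j <= i)%N]| = i.+1.
Proof.
rewrite -sum1_card (eq_bigl (fun j : 'I_p => (j < i.+1)%N))//.
rewrite -(big_ord_widen p (fun=> 1%N))//.
by rewrite sum_nat_const card_ord muln1.
Qed.

(** Column [j], counted from 0, has [p - j] entries on or below the diagonal. *)
Lemma prod_tri_col (R : comPzSemiRingType) (s : 'I_p -> R) :
  \prod_k s (tri_col k) = \prod_j s j ^+ (p - j).
Proof.
rewrite (prod_tri (fun _ j => s j)) (exchange_big_dep xpredT)//=.
by apply: eq_bigr => j _; rewrite prodr_const card_ord_ge.
Qed.

(** The index [j] occurs [p - j] times as a column and [j.+1] times as a row. *)
Lemma prod_tri_row_col (R : comPzSemiRingType) (s : 'I_p -> R) :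
  \prod_k (s (tri_row k) * s (tri_col k)) = \prod_j s j ^+ p.+1.
Proof.
rewrite big_split/= prod_tri_col (prod_tri (fun i _ => s i)) -big_split/=.
apply: eq_bigr => i _; rewrite prodr_const -exprD; congr (_ ^+ _).
by rewrite card_ord_le addSn subnKC// ltnW.
Qed.

Lemma prod_tri_diag (R : comPzSemiRingType) (s : 'I_p -> R) :
  \prod_k (if tri_row k == tri_col k then 2 * s (tri_col k) else s (tri_col k)) =
  2 ^+ p * \prod_j s j ^+ (p - j).
Proof.
rewrite -prod_tri_col.
have -> : \prod_k (if tri_row k == tri_col k then 2 * s (tri_col k) else s (tri_col k)) =
  \prod_k ((if tri_row k == tri_col k then 2 else 1) * s (tri_col k)).
  by apply: eq_bigr => k _; case: ifP; rewrite ?mul1r.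
rewrite big_split/=; congr (_ * _).
rewrite (prod_tri (fun i j => if i == j then 2 else 1)).
rewrite -[in RHS](card_ord p) -prodr_const; apply: eq_bigr => i _.
rewrite (bigD1 i)//= eqxx big1 ?mulr1// => j /andP[_ ji].
by rewrite eq_sym (negPf ji).
Qed.

End triangular_indices.

Section matrix_substitutions.
Variables (R : realType) (p : nat).
Local Notation N := #|{: tri p}|.
Implicit Types (t x y : N.-tuple R) (k : 'I_N).

Lemma tri_coordE t k : tri_coord t (tri_row k) (tri_col k) = tnth t k.
Proof. exact: tri_coord_enum_val. Qed.

Lemma low_mx_trig t : is_trig_mx (low_mx t).
Proof.
apply/is_trig_mxP => i j ij; rewrite mxE /tri_coord insubF//=.
by rewrite leqNgt ij.
Qed.

Lemma low_mx_tri_part (M : 'M[R]_p) : is_trig_mx M -> low_mx (tri_part M) = M.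
Proof.
move=> tM; apply/matrixP => i j; have [ji|ij] := leqP j i; last first.
  by rewrite (is_trig_mxP (low_mx_trig _))// (is_trig_mxP tM).
have [k [<- <-]] := tri_index ji.
by rewrite mxE tri_coordE tnth_mktuple.
Qed.

Lemma sym_mx_sym t : (sym_mx t)^T = sym_mx t.
Proof.
apply/matrixP => i j; rewrite !mxE.
by case: (ltngtP i j) => // /val_inj ->.
Qed.

Lemma sym_mxE t k : sym_mx t (tri_row k) (tri_col k) = tnth t k.
Proof. by rewrite mxE tri_col_le tri_coordE. Qed.

Lemma sym_mx_tri_part (M : 'M[R]_p) : M^T = M -> sym_mx (tri_part M) = M.
Proof.
move=> sM; have H (i j : 'I_p) : (j <= i)%N -> sym_mx (tri_part M) i j = M i j.
  move=> /tri_index[k [<- <-]].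
  by rewrite sym_mxE tnth_mktuple.
apply/matrixP => i j; have [ji|/ltnW ij] := leqP j i; first exact: H.
have -> : M i j = M j i by rewrite -[in LHS]sM mxE.
by rewrite -H// -[in LHS]sym_mx_sym mxE.
Qed.

Lemma ge0_integral_low (g : 'M[R]_p -> \bar R) :
  measurable_fun setT g -> (forall A, 0 <= g A)%E ->
  (\int[lebesgue_low p]_A g A = \int[lebesgue_tuple R N]_t g (low_mx t))%E.
Proof. exact: ge0_integral_push_sf. Qed.

Lemma ge0_integral_sym (g : 'M[R]_p -> \bar R) :
  measurable_fun setT g -> (forall A, 0 <= g A)%E ->
  (\int[lebesgue_sym p]_A g A = \int[lebesgue_tuple R N]_t g (sym_mx t))%E.
Proof. exact: ge0_integral_push_sf. Qed.

Definition lex_rank k := lex (tri_row k) (tri_col k).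
(* The map [G |-> G *m S] with [S] triangular is a triangular substitution when
   each row is read from right to left. *)
Definition rev_rank k := lex (tri_row k) (rev_ord (tri_col k)).

Lemma lex_rank_inj : injective lex_rank.
Proof. by move=> k l /lex_inj[]; exact: tri_inj. Qed.

Lemma rev_rank_inj : injective rev_rank.
Proof. by move=> k l /lex_inj[r /rev_ord_inj]; exact: tri_inj. Qed.

Lemma same_below_low k x y (i j : 'I_p) : same_below lex_rank k x y ->
  (lex i j < lex_rank k)%N -> low_mx x i j = low_mx y i j.
Proof.
move=> xy ijk; have [ji|ij] := leqP j i; last first.
  by rewrite !(is_trig_mxP (low_mx_trig _)).
have [l [li lj]] := tri_index ji; rewrite !mxE -li -lj !tri_coordE; apply: xy.
by rewrite /lex_rank li lj.
Qed.

(** An entry above the diagonal is read at its mirror image, whose row [j] is at most [tri_col k],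
    so that it still precedes [k]. *)
Lemma same_below_sym k x y (i j : 'I_p) : same_below lex_rank k x y ->
  (i <= tri_row k)%N -> (j <= tri_col k)%N ->
  (i, j) != (tri_row k, tri_col k) -> sym_mx x i j = sym_mx y i j.
Proof.
move=> xy; rewrite xpair_eqE negb_and -!val_eqE/= => ik jk ijk;
  have ck := tri_col_le k.
have [ji|ij] := leqP j i.
  have [l [li lj]] := tri_index ji; rewrite -li -lj !sym_mxE; apply: xy.
  rewrite /lex_rank ltn_lex li lj -val_eqE/=.
  lia.
rewrite -(sym_mx_sym x) -(sym_mx_sym y) mxE [RHS]mxE.
have [l [lj li]] := tri_index (ltnW ij); rewrite -li -lj !sym_mxE; apply: xy.
rewrite /lex_rank ltn_lex li lj -val_eqE/=; lia.
Qed.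

Local Open Scope ereal_scope.
Variable f : 'M[R]_p -> \bar R.
Hypotheses (mf : measurable_fun setT f) (f0 : forall A, 0 <= f A).

Let mf_low : measurable_fun setT (f \o @low_mx R p).
Proof. exact: (measurableT_comp mf (@measurable_low_mx R p)). Qed.

Let mf_sym : measurable_fun setT (f \o @sym_mx R p).
Proof. exact: (measurableT_comp mf (@measurable_sym_mx R p)). Qed.

Lemma ge0_integral_sym_sub (W : 'M[R]_p) : W^T = W ->
  \int[lebesgue_sym p]_A f A = \int[lebesgue_sym p]_A f (A - W)%R.
Proof.
move=> sW; rewrite ge0_integral_sym// [RHS]ge0_integral_sym//; last first.
  by apply: (measurableT_comp mf); apply: measurable_addmx.
rewrite (@ge0_integral_tri_subst _ _ lex_rank pred0 (fun _ _ => 1%R)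
  (fun k _ => - W (tri_row k) (tri_col k))%R lex_rank_inj _ _ _ _ _ (f \o @sym_mx R p))//=.
apply: eq_integral => x _.
rewrite ifT; last by apply/forallP.
rewrite big1 ?mule1//; congr f; rewrite -[RHS]sym_mx_tri_part; last first.
  by rewrite linearB/= sW sym_mx_sym.
congr sym_mx; apply: eq_from_tnth => k; rewrite !tnth_mktuple.
by rewrite /tri_fun/= mul1r !mxE -/(tri_row k) -/(tri_col k) tri_col_le tri_coordE.
Qed.

(** As [T] is triangular, entry [(i, j)] of [T *m U *m T^T] is [T i i * T j j * U i j] plus terms in
    entries of [U] with no larger row or column index, which come earlier. *)
Lemma ge0_integral_sym_congr (T : 'M[R]_p) : LT p T ->
  \int[lebesgue_sym p]_A f A =
  \int[lebesgue_sym p]_U (f (T *m U *m T^T) * (\prod_i (T i i) ^+ p.+1)%:E).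
Proof.
move=> TL; have [tT T0] := TL.
rewrite ge0_integral_sym// [RHS]ge0_integral_sym//; last 2 first.
- apply: emeasurable_funM; last exact: measurable_cst.
  apply: (measurableT_comp mf); apply: measurable_mulmx => //.
  exact: measurable_mulmx.
- move=> U; rewrite mule_ge0// lee_fin prodr_ge0// => i _.
  by rewrite exprn_ge0// ltW.
pose c k (x : N.-tuple R) :=
  (T (tri_row k) (tri_row k) * T (tri_col k) (tri_col k))%R.
(* Defined by subtraction, so that the substitution is the congruence by construction; [hk] shows
   that coordinate [k] cancels. *)
pose h k x := ((T *m sym_mx x *m T^T) (tri_row k) (tri_col k) - c k x * tnth x k)%R.
have mc k : measurable_fun setT (c k) by exact: measurable_cst.
have mh k : measurable_fun setT (h k).
  apply: measurable_funB; last by apply: measurable_funM => //;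
    exact: measurable_tnth.
  apply: measurable_fun_entry; apply: measurable_mulmx => //.
  by apply: measurable_mulmx => //; exact: measurable_sym_mx.
have c0 k x : ~~ pred0 k -> tri_pos lex_rank pred0 (lex_rank k) x ->
  (0 < c k x)%R.
  by move=> _ _; rewrite mulr_gt0.
have hk k x : h k x = (\sum_(ij | ij != (tri_row k, tri_col k))
    T (tri_row k) ij.1 * sym_mx x ij.1 ij.2 * T (tri_col k) ij.2)%R.
  rewrite /h mxE; under eq_bigr do rewrite mxE mulr_suml.
  rewrite exchange_big pair_big/= (bigD1 (tri_row k, tri_col k))//= [T^T _ _]mxE sym_mxE.
  rewrite /c mulrAC [X in (X - _)%R]addrC addrK.
  by apply: eq_bigr => -[i j] _ /=; rewrite [T^T _ _]mxE.
have h_below k x y : same_below lex_rank k x y -> h k x = h k y.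
  move=> xy; rewrite !hk; apply: eq_bigr => -[i j] /= ij.
  have [ki|ik] := ltnP (tri_row k) i;
    first by rewrite (is_trig_mxP tT)// !mul0r.
  have [kj|jk] := ltnP (tri_col k) j;
    first by rewrite (is_trig_mxP tT _ _ kj) !mulr0.
  by rewrite (same_below_sym xy).
rewrite (@ge0_integral_tri_subst _ _ lex_rank pred0 c h lex_rank_inj mc mh _
  h_below c0 (f \o @sym_mx R p))//=.
apply: eq_integral => x _.
rewrite ifT; last by apply/forallP.
rewrite -prod_tri_row_col; congr (f _ * _%:E).
rewrite -[RHS]sym_mx_tri_part;
  last by rewrite !trmx_mul trmxK sym_mx_sym mulmxA.
congr sym_mx; apply: eq_from_tnth => k; rewrite !tnth_mktuple.
by rewrite /tri_fun/= /h addrC subrK.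
Qed.

(** Entry [(i, j)] of [G *m S] is [G i j * S j j] plus terms in the entries of row [i] to the right
    of column [j]. *)
Lemma ge0_integral_low_mul (S : 'M[R]_p) : LT p S ->
  \int[lebesgue_low p]_A f A =
  \int[lebesgue_low p]_G (f (G *m S) * (\prod_j (S j j) ^+ (p - j))%:E).
Proof.
move=> SL; have [tS S0] := SL.
rewrite ge0_integral_low// [RHS]ge0_integral_low//; last 2 first.
- apply: emeasurable_funM; last exact: measurable_cst.
  by apply: (measurableT_comp mf); exact: measurable_mulmx.
- move=> U; rewrite mule_ge0// lee_fin prodr_ge0// => i _.
  by rewrite exprn_ge0// ltW.
pose c k (x : N.-tuple R) := S (tri_col k) (tri_col k).
pose h k x := ((low_mx x *m S) (tri_row k) (tri_col k) - c k x * tnth x k)%R.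
have mc k : measurable_fun setT (c k) by exact: measurable_cst.
have mh k : measurable_fun setT (h k).
  apply: measurable_funB; last by apply: measurable_funM => //;
    exact: measurable_tnth.
  apply: measurable_fun_entry; apply: measurable_mulmx => //.
  exact: measurable_low_mx.
have c0 k x : ~~ pred0 k -> tri_pos rev_rank pred0 (rev_rank k) x ->
  (0 < c k x)%R by move=> _ _; exact: S0.
have hk k x : h k x = (\sum_(j | j != tri_col k)
    low_mx x (tri_row k) j * S j (tri_col k))%R.
  rewrite /h mxE (bigD1 (tri_col k))//= [low_mx _ _ _]mxE tri_coordE.
  by rewrite /c [X in (X - _)%R]addrC mulrC addrK.
have h_below k x y : same_below rev_rank k x y -> h k x = h k y.
  move=> xy; rewrite !hk; apply: eq_bigr => j jk.
  have [kj|] := ltnP (tri_col k) j; last first.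
    rewrite leq_eqVlt val_eqE (negPf jk)/= => kj.
    by rewrite (is_trig_mxP tS _ _ kj) !mulr0.
  congr (_ * _)%R; have [jr|rj] := leqP j (tri_row k); last first.
    by rewrite !(is_trig_mxP (low_mx_trig _)).
  have [l [li lj]] := tri_index jr; rewrite !mxE -li -lj !tri_coordE; apply: xy.
  rewrite /rev_rank li lj ltn_lex eqxx ltnn/=; have := ltn_ord j; lia.
rewrite (@ge0_integral_tri_subst _ _ rev_rank pred0 c h rev_rank_inj mc mh _
  h_below c0 (f \o @low_mx R p))//=.
apply: eq_integral => x _.
rewrite ifT; last by apply/forallP.
rewrite -prod_tri_col; congr (f _ * _%:E).
rewrite -[RHS]low_mx_tri_part; last by apply: mulmx_trig => //;
  exact: low_mx_trig.
congr low_mx; apply: eq_from_tnth => k; rewrite !tnth_mktuple.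
by rewrite /tri_fun/= /h addrC subrK.
Qed.

End matrix_substitutions.

Section gram_substitution.
Variables (R : realType) (p : nat).
Local Notation N := #|{: tri p}|.
Local Open Scope ereal_scope.
Variable f : 'M[R]_p -> \bar R.
Hypotheses (mf : measurable_fun setT f) (f0 : forall A, 0 <= f A).
Hypothesis fPD : forall A, f A != 0 -> PD p A.

Let mf_sym : measurable_fun setT (f \o @sym_mx R p).
Proof. exact: (measurableT_comp mf (@measurable_sym_mx R p)). Qed.

Let sq (k : 'I_N) := tri_row k == tri_col k.
Let c (k : 'I_N) (x : N.-tuple R) :=
  if sq k then 1%R else low_mx x (tri_col k) (tri_col k).
Let h (k : 'I_N) (x : N.-tuple R) := (\sum_(q < p | (q < tri_col k)%N)
  low_mx x (tri_row k) q * low_mx x (tri_col k) q)%R.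

Let mc k : measurable_fun setT (c k).
Proof.
rewrite /c; case: (sq k) => //.
by apply: measurable_fun_entry; exact: measurable_low_mx.
Qed.

Let mh k : measurable_fun setT (h k).
Proof.
rewrite (_ : h k = fun x => (\sum_(q < p) if (q < tri_col k)%N then
    low_mx x (tri_row k) q * low_mx x (tri_col k) q else 0)%R); last first.
  by apply/funext => x; rewrite /h big_mkcond.
apply: measurable_sum => q; case: (q < _)%N => //.
by apply: measurable_funM; apply: measurable_fun_entry;
  exact: measurable_low_mx.
Qed.

Let h_below k x y : same_below (@lex_rank p) k x y -> h k x = h k y.
Proof.
move=> xy; apply: eq_bigr => q qk; have ck := tri_col_le k.
rewrite !(same_below_low xy)// /lex_rank ltn_lex -val_eqE/=; lia.
Qed.

Let tri_fun_gram k x :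
  tri_fun sq c h k x = (low_mx x *m (low_mx x)^T) (tri_row k) (tri_col k).
Proof.
rewrite trig_gramE ?low_mx_trig// /tri_fun /h /c -tri_coordE.
have -> : tri_coord x (tri_row k) (tri_col k) =
  low_mx x (tri_row k) (tri_col k).
  by rewrite mxE.
by case: (boolP (sq k)) => [/eqP ->|_]; rewrite ?expr2// [X in (X + _)%R]mulrC.
Qed.

Let diag_pos m (x : N.-tuple R) i : tri_pos (@lex_rank p) sq m x ->
  (lex i i < m)%N ->
  (0 < low_mx x i i)%R.
Proof.
move=> /forallP xm im; have [k [ki kj]] := tri_index (leqnn i).
have := xm k; rewrite /sq /lex_rank ki kj eqxx im/= -tri_coordE ki kj.
by rewrite mxE.
Qed.

Let sqPn k : ~~ sq k -> (tri_col k < tri_row k)%N.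
Proof. by move=> k'; rewrite ltn_neqAle tri_col_le andbT eq_sym. Qed.

Let c_below k (x y : N.-tuple R) : same_below (@lex_rank p) k x y ->
  c k x = c k y.
Proof.
move=> xy; rewrite /c; case: ifPn => // /sqPn ck.
by rewrite (same_below_low xy)// /lex_rank ltn_lex ck.
Qed.

Let c_gt0 k (x : N.-tuple R) : ~~ sq k ->
  tri_pos (@lex_rank p) sq (lex_rank k) x -> (0 < c k x)%R.
Proof.
move=> sk /diag_pos; rewrite /c (negPf sk); apply; have ck := sqPn sk.
by rewrite /lex_rank ltn_lex ck.
Qed.

(** Where [f] does not vanish, the partly substituted matrix [A] is positive definite. Its Cholesky
    factor [T] agrees with [x] before entry [k], by uniqueness of prefixes, so that the diagonal
    entry of [A] at [k] is [h k x] plus the square of a positive number. *)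
Let f_supp k (x : N.-tuple R) : sq k ->
  tri_pos (@lex_rank p) sq (lex_rank k) x ->
  f (sym_mx (tri_subst (@lex_rank p) sq c h (lex_rank k) x)) != 0 ->
  (h k x < tnth x k)%R.
Proof.
move=> /eqP rc xk /fPD/chol_gram; set A := sym_mx _;
  set T := chol A => -[TL TA].
have [tT T0] := TL.
have Tx := @gram_prefix_inj R p T (low_mx x) (lex_rank k) tT (low_mx_trig x)
  (fun i _ => T0 i) (fun i => diag_pos xk).
have {}Tx (i j : 'I_p) : (j <= i)%N -> (lex i j < lex_rank k)%N ->
  T i j = low_mx x i j.
  move=> ji ijk; apply: Tx => // {ji ijk} i' j' ji ijk.
  have [l [li lj]] := tri_index ji.
  rewrite TA -li -lj sym_mxE tnth_mktuple -tri_fun_gram.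
  by rewrite ifT// /lex_rank li lj.
have -> : tnth x k = A (tri_row k) (tri_col k).
  by rewrite sym_mxE tnth_mktuple ltnn.
rewrite -TA trig_gramE// rc [ltLHS](_ : _ = \sum_(q < p | (q < tri_col k)%N)
    T (tri_col k) q * T (tri_col k) q)%R; last first.
  apply: eq_bigr => q qk; rewrite ?rc -!Tx//; try exact: ltnW.
  by rewrite /lex_rank ltn_lex rc eqxx qk orbT.
by rewrite ltrDr mulr_gt0.
Qed.

(** A diagonal entry contributes the derivative [2 * T j j] of its square, any other entry of column
    [j] the slope [T j j]. *)
Lemma ge0_integral_gram :
  \int[lebesgue_sym p]_A f A =
  \int[lebesgue_low p]_(T in LT p)
    (f (T *m T^T) * (2 ^+ p * \prod_j (T j j) ^+ (p - j))%:E).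
Proof.
have mfg : measurable_fun setT (fun T : 'M[R]_p =>
    f (T *m T^T) * (2 ^+ p * \prod_j (T j j) ^+ (p - j))%:E).
  apply: emeasurable_funM.
    apply: (measurableT_comp mf); apply: measurable_mulmx => //.
    exact: measurable_trmx.
  apply/measurable_EFinP; apply: measurable_funM => //.
  apply: measurable_prod => j _; apply: measurable_funX.
  exact: measurable_entry.
rewrite [RHS]integral_mkcond ge0_integral_sym// [RHS]ge0_integral_low;
  last 2 first.
- by apply: measurable_fun_patch => //; exact: measurable_LT.
- apply: erestrict_ge0 => T [_ T0];
  rewrite mule_ge0// lee_fin mulr_ge0// ?exprn_ge0//.
  by rewrite prodr_ge0// => j _; rewrite exprn_ge0// ltW.
rewrite (@ge0_integral_tri_subst _ _ (@lex_rank p) sq c h (@lex_rank_inj p) mc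
  mh c_below h_below
  c_gt0 (f \o @sym_mx R p))//=.
apply: eq_integral => x _; rewrite patchE.
(* [low_mx x] is always triangular, so the domain of the substitution is exactly [LT p]. *)
have -> : (low_mx x \in LT p) = [forall k, sq k ==> (0 < tnth x k)%R].
  apply/idP/forallP.
    rewrite inE => -[_ x0] k; apply/implyP => /eqP rc.
    by rewrite -tri_coordE rc; have := x0 (tri_col k); rewrite mxE.
  move=> xk; rewrite inE; split; first exact: low_mx_trig.
  move=> i; have [k [ki kj]] := tri_index (leqnn i).
  by have := xk k; rewrite /sq ki kj eqxx/= -tri_coordE ki kj mxE.
case: ifPn => _; last by rewrite mule0.
congr (f _ * _%:E).
  rewrite -[RHS]sym_mx_tri_part ?trmx_mul ?trmxK//; congr sym_mx.
  by apply: eq_from_tnth => k; rewrite !tnth_mktuple tri_fun_gram.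
rewrite -(prod_tri_diag (fun j => low_mx x j j)); apply: eq_bigr => k _.
rewrite /tri_jac /c -/(sq k); case: (boolP (sq k)) => // /eqP rc.
by rewrite -tri_coordE rc mxE.
Qed.

End gram_substitution.

(** * The decomposition of a pair of positive definite matrices *)

Section decomposition.
Variables (R : realType) (p : nat).
Implicit Types (U G T : 'M[R]_p) (W : 'M[R]_p * 'M[R]_p).

Definition PD2 : set ('M[R]_p * 'M[R]_p) := PD p `*` PD p.

Lemma measurable_PD2 : measurable PD2.
Proof. by apply: measurableX; exact: measurable_PD. Qed.

Lemma PD_unitP U : PD_unit p U <-> PD p U /\ PD p (1%:M - U).
Proof. by rewrite /PD_unit /mx_lt /= subr0. Qed.

(** The inverse of [W |-> (T_of W, U_of W)]; [z_at S U] is its value at [(S U, U)]. *)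
Definition congr_pair T U : 'M[R]_p * 'M[R]_p :=
  (T *m U *m T^T, T *m (1%:M - U) *m T^T).

Lemma congr_pair_add T U : (congr_pair T U).1 + (congr_pair T U).2 = T *m T^T.
Proof. by rewrite /= -mulmxDl -mulmxDr subrKC mulmx1. Qed.

Lemma congr_pair_subr T U : T *m T^T - T *m U *m T^T = T *m (1%:M - U) *m T^T.
Proof. by rewrite mulmxBr mulmxBl mulmx1. Qed.

Lemma PD_congrP T U : LT p T -> PD p (T *m U *m T^T) <-> PD p U.
Proof.
move=> TL; have uT := LT_unit TL; split; last exact: PD_congr.
have uV : invmx T \in unitmx by rewrite unitmx_inv.
move=> /(PD_congr uV); rewrite trmx_inv !mulmxA mulVmx// mul1mx -mulmxA.
by rewrite mulmxV ?unitmx_tr// mulmx1.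
Qed.

Lemma PD2_congr_pair T U : LT p T -> PD2 (congr_pair T U) <-> PD_unit p U.
Proof.
move=> TL; rewrite PD_unitP.
by split => -[/(PD_congrP _ TL)? /(PD_congrP _ TL)?].
Qed.

Lemma U_of_congr_pair T U : LT p T -> U_of (congr_pair T U) = U.
Proof.
move=> TL; have uT := LT_unit TL.
rewrite /U_of (T_ofE TL) ?congr_pair_add//=.
by rewrite trmx_inv !mulmxA mulVmx// mul1mx -mulmxA mulmxV ?unitmx_tr// mulmx1.
Qed.

Lemma LT_T_of W : PD2 W -> LT p (T_of W).
Proof.
move=> [W1 W2]; have W12 := PD_add W1 W2.
by rewrite T_of_chol//; have [] := chol_gram W12.
Qed.

Lemma congr_pair_U_of W : PD2 W -> congr_pair (T_of W) (U_of W) = W.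
Proof.
move=> W12; have TL := LT_T_of W12; have uT := LT_unit TL.
have TW : T_of W *m (T_of W)^T = W.1 + W.2.
  have := PD_add W12.1 W12.2; move=> W12'.
  by rewrite T_of_chol//; have [] := chol_gram W12'.
have E1 : T_of W *m U_of W *m (T_of W)^T = W.1.
  by rewrite /U_of trmx_inv !mulmxA mulmxV// mul1mx -mulmxA mulVmx ?unitmx_tr// mulmx1.
by rewrite /congr_pair -congr_pair_subr E1 TW addrC addKr -surjective_pairing.
Qed.

Lemma PD_unit_U_of W : PD2 W -> PD_unit p (U_of W).
Proof.
move=> W12; apply/(PD2_congr_pair _ (LT_T_of W12)).
by rewrite congr_pair_U_of.
Qed.

Lemma z_atE (S : 'M[R]_p -> 'M[R]_p) U : z_at S U = congr_pair (S U) U.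
Proof. by []. Qed.

(* [U_chol], [g_chol] and [z_patch] agree with [U_of], [g_of S] and [z_at S]
   where the latter are relevant, and are measurable everywhere. *)
Definition U_chol W := invmx (chol (W.1 + W.2)) *m W.1 *m (invmx (chol (W.1 + W.2)))^T.

Lemma U_cholE W : PD2 W -> U_of W = U_chol W.
Proof. by move=> [W1 W2]; rewrite /U_of T_of_chol//; exact: PD_add. Qed.

Lemma measurable_cholD : measurable_fun setT (fun W => chol (W.1 + W.2)).
Proof.
apply: (measurableT_comp (measurable_chol (p := p))).
by apply: measurable_addmx.
Qed.

Lemma measurable_U_chol : measurable_fun setT U_chol.
Proof.
have mV := measurable_invmx measurable_cholD.
apply: measurable_mulmx; last exact: measurable_trmx.
by apply: measurable_mulmx.
Qed.

Lemma measurable_congr_pair d (X : measurableType d) (T U : X -> 'M[R]_p) :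
  measurable_fun setT T -> measurable_fun setT U ->
  measurable_fun setT (fun x => congr_pair (T x) (U x)).
Proof.
move=> mT mU; apply/measurable_fun_pairP; split => /=.
  by apply: measurable_mulmx; [exact: measurable_mulmx|exact: measurable_trmx].
apply: measurable_mulmx; last exact: measurable_trmx.
apply: measurable_mulmx => //; apply: measurable_addmx => //.
exact: measurable_oppmx.
Qed.

Variable S : 'M[R]_p -> 'M[R]_p.
Hypothesis SL : forall U, PD_unit p U -> LT p (S U).
Hypothesis mS : measurable_fun (PD_unit p) S.

Let S0 := S \_ (PD_unit p).

Let mS0 : measurable_fun setT S0.
Proof. by apply/(measurable_restrictT S (@measurable_PD_unit R p)). Qed.

Let S0E U : PD_unit p U -> S U = S0 U.
Proof. by move=> Uu; rewrite /S0 patchE mem_set. Qed.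

Definition g_chol W := chol (W.1 + W.2) *m invmx ((S \_ (PD_unit p)) (U_chol W)).

Lemma g_cholE W : PD2 W -> g_of S W = g_chol W.
Proof.
move=> W12; rewrite /g_of T_of_chol; last exact: (PD_add W12.1 W12.2).
by rewrite (S0E (PD_unit_U_of W12)) U_cholE.
Qed.

Lemma measurable_g_chol : measurable_fun setT g_chol.
Proof.
apply: measurable_mulmx; first exact: measurable_cholD.
by apply: measurable_invmx; exact: (measurableT_comp mS0 measurable_U_chol).
Qed.

Definition z_patch U := congr_pair ((S \_ (PD_unit p)) U) U.

Lemma z_patchE U : PD_unit p U -> z_at S U = z_patch U.
Proof. by move=> Uu; rewrite z_atE (S0E Uu). Qed.

Lemma measurable_z_patch : measurable_fun setT z_patch.
Proof. exact: measurable_congr_pair. Qed.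

(** An image need not be measurable, but [U_of] inverts [z_at S], which makes [Zset S] the set of
    fixed points of a measurable retraction. *)
Lemma ZsetE : Zset S = PD2 `&` [set W | z_patch (U_chol W) = W].
Proof.
apply/seteqP; split => W.
  move=> [U Uu <-].
  have zP : PD2 (z_at S U) by apply/PD2_congr_pair => //; exact: SL.
  split=> //=; rewrite -U_cholE// z_atE U_of_congr_pair; last exact: SL.
  by rewrite -z_patchE.
move=> [W12 /= WE]; exists (U_of W); first exact: PD_unit_U_of.
by rewrite z_patchE ?U_cholE//; rewrite -U_cholE//; exact: PD_unit_U_of.
Qed.

Lemma measurable_Zset : measurable (Zset S).
Proof.
have mzU := measurableT_comp measurable_z_patch measurable_U_chol.
rewrite ZsetE; apply: measurableI; first exact: measurable_PD2.
rewrite (_ : mkset _ = [set W | (z_patch (U_chol W)).1 = W.1] `&`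
    [set W | (z_patch (U_chol W)).2 = W.2]).
  apply: measurableI; apply: measurable_eq_mx => //.
  - exact: (measurableT_comp measurable_fst mzU).
  - exact: (measurableT_comp measurable_snd mzU).
apply/seteqP; split => W; rewrite /mkset; first by move=> E; split;
  [exact: (congr1 fst E)|exact: (congr1 snd E)].
move=> [E1 E2]; rewrite [RHS]surjective_pairing -[W.1]E1 -[W.2]E2.
exact: surjective_pairing.
Qed.

Lemma g_of_congr_pair G U : LT p G -> PD_unit p U ->
  g_of S (congr_pair (G *m S U) U) = G.
Proof.
move=> GL Uu; have TL := LT_mul GL (SL Uu).
rewrite /g_of U_of_congr_pair// (T_ofE TL) ?congr_pair_add//.
by rewrite mulmxK// LT_unit//; exact: SL.
Qed.

End decomposition.

(** * Change of variables from the pair of matrices to G and U *)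

Section change_of_variables.
Variables (R : realType) (p : nat).
Implicit Types (U G T : 'M[R]_p) (W : 'M[R]_p * 'M[R]_p).
Local Open Scope ereal_scope.

Lemma eq_integral_low (f g : 'M[R]_p -> \bar R) :
  measurable_fun setT f -> (forall A, 0 <= f A) ->
  measurable_fun setT g -> (forall A, 0 <= g A) ->
  (forall A, is_trig_mx A -> f A = g A) ->
  \int[lebesgue_low p]_A f A = \int[lebesgue_low p]_A g A.
Proof.
move=> mf f0 mg g0 fg; rewrite !ge0_integral_low//.
by apply: eq_integral => t _; rewrite fg// low_mx_trig.
Qed.

Lemma mulmx_trig_diag (X Y : 'M[R]_p) i : is_trig_mx X -> is_trig_mx Y ->
  (X *m Y) i i = (X i i * Y i i)%R.
Proof.
move=> /is_trig_mxP tX /is_trig_mxP tY.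
rewrite mxE (bigD1 i)//= big1 ?addr0// => k; rewrite -val_eqE/=.
by case: ltngtP => // ki _; [rewrite tY ?mulr0|rewrite tX ?mul0r].
Qed.

(* With [j] counted from 0, the Jacobian of [T |-> T *m T^T] times that of
   [U |-> T *m U *m T^T]. *)
Definition low_jac T := (2 ^+ p * (\prod_j T j j ^+ (p - j)) * (\prod_j T j j ^+ p.+1))%R.

Lemma measurable_low_jac : measurable_fun setT low_jac.
Proof.
apply: measurable_funM; first apply: measurable_funM => //.
- by apply: measurable_prod => j _; apply: measurable_funX;
  exact: measurable_entry.
- by apply: measurable_prod => j _; apply: measurable_funX;
  exact: measurable_entry.
Qed.

Lemma low_jac_ge0 T : LT p T -> (0 <= low_jac T)%R.
Proof.
move=> [_ T0]; have T0n (n : 'I_p -> nat) : (0 <= \prod_j T j j ^+ n j)%R.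
  by apply: prodr_ge0 => j _; rewrite exprn_ge0// ltW.
by rewrite /low_jac !mulr_ge0// exprn_ge0.
Qed.

Variable S : 'M[R]_p -> 'M[R]_p.
Hypothesis SL : forall U, PD_unit p U -> LT p (S U).
Hypothesis mS : measurable_fun (PD_unit p) S.

Variable F : 'M[R]_p * 'M[R]_p -> \bar R.
Hypotheses (mF : measurable_fun setT F) (F0 : forall W, 0 <= F W).

Let F1 := F \_ (@PD2 R p).

Let mF1 : measurable_fun setT F1.
Proof. by apply: measurable_fun_patch => //; exact: measurable_PD2. Qed.

Let F1_ge0 W : 0 <= F1 W.
Proof. exact: erestrict_ge0. Qed.

Let F1_out W : ~ PD2 W -> F1 W = 0.
Proof. by move=> W12; rewrite /F1 patchE memNset. Qed.

Let mF1sub : measurable_fun setT (fun W => F1 (W.1, W.2 - W.1)%R).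
Proof.
apply: (measurableT_comp mF1); apply/measurable_fun_pairP; split.
  exact: measurable_fst.
apply: (measurable_addmx (f := snd) (g := fun W => - W.1)%R) => //.
exact: measurable_oppmx.
Qed.

Let integral_sub :
  \int[lebesgue_sym p \x lebesgue_sym p]_W F1 W =
  \int[lebesgue_sym p]_A \int[lebesgue_sym p]_W1 F1 (W1, A - W1)%R.
Proof.
rewrite (fubini_tonelli1 F1 mF1 F1_ge0).
rewrite -(fubini_tonelli (fun W => F1 (W.1, W.2 - W.1)%R) mF1sub (fun=> F1_ge0 _)).
apply: eq_integral => W1 _; rewrite /fubini_F.
(* Translation preserves symmetric matrices only if [W1] is symmetric; otherwise [F1] vanishes. *)
have [sW1|sW1] := eqVneq W1^T W1.
  apply: (@ge0_integral_sym_sub R p (fun A => F1 (W1, A))) => //.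
  exact: (measurableT_comp mF1 (pair1_measurable W1)).
have W10 A : F1 (W1, A) = 0.
  by apply: F1_out => -[/PD_sym/eqP]; rewrite (negPf sW1).
by rewrite !integral0_eq.
Qed.

Let F2 := (fun z => F1 (congr_pair z.1 z.2) * (low_jac z.1)%:E) \_ (LT p `*` setT).

Let mLT := @measurable_LT R p.

Let mF2 : measurable_fun setT F2.
Proof.
apply: measurable_fun_patch; first exact: measurableX.
apply: emeasurable_funM.
  by apply: (measurableT_comp mF1); exact: measurable_congr_pair.
apply/measurable_EFinP.
exact: (measurableT_comp measurable_low_jac measurable_fst).
Qed.

Let F2_ge0 z : 0 <= F2 z.
Proof.
apply: erestrict_ge0 => -[T U] [/= TL _].
by rewrite mule_ge0// lee_fin low_jac_ge0.
Qed.

(** The inner integral, a function of [A = W1 + W2], vanishes off [PD], as the Gram substitution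
    requires. The congruence is applied for fixed [T]; then the order of integration is exchanged,
    so that the next substitution can take place at fixed [U]. *)
Let integral_low_sym :
  \int[lebesgue_sym p \x lebesgue_sym p]_W F1 W =
  \int[lebesgue_sym p]_U \int[lebesgue_low p]_T F2 (T, U).
Proof.
rewrite integral_sub.
pose f A := \int[lebesgue_sym p]_W1 F1 (W1, A - W1)%R.
have mf : measurable_fun setT f.
  exact: (measurable_fun_fubini_tonelli_G (m1 := lebesgue_sym p)
    (fun W => F1 (W.1, W.2 - W.1)%R)).
have f0 A : 0 <= f A by exact: integral_ge0.
have fPD A : f A != 0 -> PD p A.
  apply: contraPP => nPD; apply/negP; rewrite negbK; apply/eqP.
  apply: integral0_eq => W1 _; apply: F1_out => -[/= P1 P2].
  by apply: nPD; rewrite -(subrKC W1 A); exact: PD_add.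
rewrite (ge0_integral_gram mf f0 fPD) -(fubini_tonelli F2)//.
rewrite integral_mkcond; apply: eq_integral => T _; rewrite patchE.
case: ifPn => [|nT]; last first.
  rewrite integral0_eq// => U _; rewrite /F2 patchE memNset//= => -[] TL.
  by move: nT; rewrite notin_setE.
rewrite inE => TL.
have T0n (n : 'I_p -> nat) : (0 <= \prod_j T j j ^+ n j)%R.
  by apply: prodr_ge0 => j _; rewrite exprn_ge0// ltW//; have [] := TL.
have mg : measurable_fun setT (fun U => F1 (U, T *m T^T - U)%R).
  apply: (measurableT_comp mF1); apply/measurable_fun_pairP; split.
    exact: measurable_id.
  apply: (measurable_addmx (f := cst (T *m T^T)) (g := fun U => - U)%R) => //.
  exact: measurable_oppmx.
rewrite /f (ge0_integral_sym_congr mg _ TL)//.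
rewrite -ge0_integralZr//; last 3 first.
- apply: emeasurable_funM; last exact: measurable_cst.
  have mTU : measurable_fun setT (fun U => T *m U *m T^T).
    by apply: measurable_mulmx => //; exact: measurable_mulmx.
  exact: (measurableT_comp mg mTU).
- by move=> U _; rewrite mule_ge0// lee_fin T0n.
- by rewrite lee_fin mulr_ge0 ?exprn_ge0// T0n.
apply: eq_integral => U _.
rewrite /F2 patchE mem_set//= congr_pair_subr /low_jac -muleA -EFinM.
by rewrite [X in X%:E]mulrC.
Qed.

(* The last product is the Jacobian of [G |-> G *m S z.2]. *)
Definition jac (z : 'M[R]_p * 'M[R]_p) :=
  (low_jac (z.1 *m S z.2) * \prod_j S z.2 j j ^+ (p - j))%R.

Let S0 := S \_ (PD_unit p).
Let mS0 : measurable_fun setT S0.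
Proof. by apply/(measurable_restrictT S (@measurable_PD_unit R p)). Qed.
Let S0E U : PD_unit p U -> S0 U = S U.
Proof. by move=> Uu; rewrite /S0 patchE mem_set. Qed.

Let mPDu := @measurable_PD_unit R p.

Let F3 := (fun z => F (congr_pair (z.1 *m S0 z.2) z.2) *
  (low_jac (z.1 *m S0 z.2) * \prod_j S0 z.2 j j ^+ (p - j))%:E) \_ (LT p `*` PD_unit p).

Let mF3 : measurable_fun setT F3.
Proof.
have mS2 : measurable_fun setT (fun z : 'M[R]_p * 'M[R]_p => S0 z.2).
  exact: (measurableT_comp mS0 measurable_snd).
have mGS : measurable_fun setT (fun z : 'M[R]_p * 'M[R]_p => z.1 *m S0 z.2).
  exact: measurable_mulmx.
apply: measurable_fun_patch; first exact: measurableX.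
apply: emeasurable_funM.
  by apply: (measurableT_comp mF); exact: measurable_congr_pair.
apply/measurable_EFinP; apply: measurable_funM.
  exact: (measurableT_comp measurable_low_jac mGS).
by apply: measurable_prod => j _; apply: measurable_funX;
  exact: measurable_fun_entry.
Qed.

Let F3_ge0 z : 0 <= F3 z.
Proof.
apply: erestrict_ge0 => -[G U] [/= GL Uu];
  rewrite mule_ge0// lee_fin mulr_ge0//.
  by apply: low_jac_ge0; apply: LT_mul => //; rewrite S0E//; exact: SL.
rewrite S0E//; apply: prodr_ge0 => j _; rewrite exprn_ge0// ltW//.
by have [] := SL Uu.
Qed.

(** At fixed [U] the factor [S U] is a constant matrix, and [T = G *m S U] is linear in [G]. Thus
    [S] is never differentiated; measurability and values in [LT p] suffice. *)
Lemma ge0_integral_PD2 :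
  \int[lebesgue_sym p \x lebesgue_sym p]_(W in @PD2 R p) F W =
  \int[lebesgue_low p \x lebesgue_sym p]_(z in LT p `*` PD_unit p)
    (F (congr_pair (z.1 *m S z.2) z.2) * (jac z)%:E).
Proof.
rewrite integral_mkcond integral_low_sym.
transitivity (\int[lebesgue_low p \x lebesgue_sym p]_z F3 z); last first.
  rewrite [RHS]integral_mkcond; apply: eq_integral => z _.
  rewrite /F3 !patchE; case: ifPn => //; rewrite inE => -[_ /= zu].
  by rewrite /jac S0E.
rewrite (fubini_tonelli2 F3 mF3 F3_ge0); apply: eq_integral => U _.
rewrite /fubini_G.
have [Uu|Uu] := pselect (PD_unit p U); last first.
  rewrite !integral0_eq// => T _; last by rewrite /F3 patchE memNset// => -[].
  rewrite /F2 patchE; case: ifPn => //; rewrite inE => -[/= TL _].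
  by rewrite F1_out ?mul0e// => /(PD2_congr_pair _ TL).
have SU := SL Uu; have [tS s0] := SU.
have mF2U : measurable_fun setT (fun T => F2 (T, U)).
  exact: (measurableT_comp mF2 (pair2_measurable U)).
rewrite (ge0_integral_low_mul mF2U _ SU)//.
(* It is enough to compare at triangular [G], where [G] and [G *m S U] lie in [LT p] together. *)
apply: eq_integral_low.
- apply: emeasurable_funM; last exact: measurable_cst.
  by apply: (measurableT_comp mF2U); exact: measurable_mulmx.
- move=> G; rewrite mule_ge0// lee_fin; apply: prodr_ge0 => j _.
  by rewrite exprn_ge0// ltW.
- exact: (measurableT_comp mF3 (pair2_measurable U)).
- by move=> G.
move=> G tG.
have GSL : LT p (G *m S U) <-> LT p G.
  split=> [[_ GS0]|GL]; last exact: LT_mul.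
  by split=> // i; have := GS0 i; rewrite mulmx_trig_diag// pmulr_lgt0.
rewrite /F2 /F3 !patchE; case: ifPn => [|nGS].
  rewrite inE => -[/= /GSL GL _]; rewrite mem_set//= S0E//.
  have -> : F1 (congr_pair (G *m S U) U) = F (congr_pair (G *m S U) U).
    by rewrite /F1 patchE mem_set//; apply/PD2_congr_pair => //; exact/GSL.
  by rewrite [in RHS]EFinM muleA.
rewrite mul0e memNset// => -[/= /GSL GL _].
by move: nGS; rewrite notin_setE; apply.
Qed.

End change_of_variables.

(** * Exponents of the diagonal entries *)

Section weights.
Variables (R : realType) (p : nat) (a b : R) (S : 'M[R]_p -> 'M[R]_p).
Implicit Types (U G T : 'M[R]_p) (W : 'M[R]_p * 'M[R]_p).
Hypothesis SL : forall U, PD_unit p U -> LT p (S U).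
Hypothesis mS : measurable_fun (PD_unit p) S.

Definition det_weight W : R :=
  (\det W.1) `^ (a - (p%:R + 1) / 2) * (\det W.2) `^ (b - (p%:R + 1) / 2).

Definition G_weight G : R := \prod_(i < p) (G i i) `^ (2 * (a + b) - i.+1%:R).

Definition U_weight U : R :=
  \prod_(i < p) (S U i i) `^ (2 * (a + b) + p%:R - 2 * i.+1%:R + 1) *
  (\det U) `^ (a - (p%:R + 1) / 2) * (\det (1%:M - U)) `^ (b - (p%:R + 1) / 2).

Lemma G_weight_ge0 G : 0 <= G_weight G.
Proof. by apply: prodr_ge0 => i _; exact: powR_ge0. Qed.

Lemma U_weight_ge0 U : 0 <= U_weight U.
Proof.
by rewrite /U_weight !mulr_ge0 ?powR_ge0//; apply: prodr_ge0 => i _;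
  exact: powR_ge0.
Qed.

Lemma measurable_powR_fun d (X : measurableType d) (f : X -> R) (r : R) :
  measurable_fun setT f -> measurable_fun setT (fun x => f x `^ r).
Proof. by move=> mf; exact: (measurableT_comp (measurable_powR r) mf). Qed.

Lemma measurable_det_weight : measurable_fun setT det_weight.
Proof.
by apply: measurable_funM; apply: measurable_powR_fun; exact: measurable_det.
Qed.

Lemma measurable_G_weight : measurable_fun setT G_weight.
Proof.
by apply: measurable_prod => i _; apply: measurable_powR_fun;
  exact: measurable_entry.
Qed.

Lemma measurable_U_weight : measurable_fun (PD_unit p) U_weight.
Proof.
have mUu := @measurable_PD_unit R p.
apply: measurable_funM; first apply: measurable_funM.
- apply: measurable_prod => i _.
  apply: (measurableT_comp (measurable_powR _)).
  exact: (measurableT_comp (measurable_entry i i) mS).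
- by apply: measurable_funTS; apply: measurable_powR_fun; exact: measurable_det.
- apply: measurable_funTS; apply: measurable_powR_fun; apply: measurable_det.
  by apply: measurable_addmx => //; exact: measurable_oppmx.
Qed.

Lemma det_PD_gt0 (A : 'M[R]_p) : PD p A -> 0 < \det A.
Proof.
move=> /chol_gram[[tT T0] <-]; rewrite det_mulmx det_tr -expr2 exprn_gt0//.
by rewrite det_trig// prodr_gt0.
Qed.

Lemma powR_prod (I : finType) (x : I -> R) (r : R) : (forall i, 0 <= x i) ->
  (\prod_i x i) `^ r = \prod_i (x i) `^ r.
Proof.
move=> x0; suff [] : (\prod_i x i) `^ r =
  \prod_i (x i) `^ r /\ 0 <= \prod_i x i by [].
elim/big_rec2 : _ => [|i y z _ [zy z0]]; first by rewrite powR1.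
by rewrite powRM// zy mulr_ge0.
Qed.

(** With [i] counted from 0, each [T i i = G i i * S U i i] has exponent [2 * (a + b) - 2 * (p + 1)]
    from the determinants and [(p - i) + (p + 1)] from [low_jac], in all [2 * (a + b) - (i + 1)];
    the map [G |-> G *m S U] adds [p - i] for [S U i i]. *)
Lemma weight_congr_pair G U : LT p G -> PD_unit p U ->
  det_weight (congr_pair (G *m S U) U) * jac S (G, U) =
  G_weight G * (2 ^+ p * U_weight U).
Proof.
move=> GL Uu; have SU := SL Uu; have TL := LT_mul GL SU.
have [/PD_unitP[/det_PD_gt0 U0 /det_PD_gt0 V0]] := conj Uu Uu.
have g0 i : 0 < G i i by case: GL.
have s0 i : 0 < S U i i by case: SU.
rewrite /det_weight /jac /low_jac /= !det_mulmx !det_tr -det_mulmx LT_det//.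
have t i : (G *m S U) i i = G i i * S U i i.
  by rewrite mulmx_trig_diag//; [case: GL|case: SU].
under eq_bigr do rewrite t.
under [X in _ * (_ * X * _ * _)]eq_bigr do rewrite t.
under [X in _ * (_ * _ * X * _)]eq_bigr do rewrite t.
have gs0 i : 0 <= G i i * S U i i by rewrite ltW// mulr_gt0.
rewrite !powRM ?mulr_ge0 ?prodr_ge0// ?ltW// !powR_prod//.
rewrite /G_weight /U_weight.
set al := a - _; set be := b - _.
transitivity (2 ^+ p *
  (\prod_i ((G i i * S U i i) `^ al * (G i i * S U i i) `^ al *
            (G i i * S U i i) `^ be * (G i i * S U i i) `^ be *
            (G i i * S U i i) ^+ (p - i) * (G i i * S U i i) ^+ p.+1 *
            S U i i ^+ (p - i))) *
  (\det U `^ al * \det (1%:M - U) `^ be)).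
  by rewrite !big_split/=; ring.
rewrite [RHS](_ : _ = 2 ^+ p * (\prod_i ((G i i) `^ (2 * (a + b) - i.+1%:R) *
  (S U i i) `^ (2 * (a + b) + p%:R - 2 * i.+1%:R + 1))) *
   (\det U `^ al * \det (1%:M - U) `^ be)); last by rewrite !big_split/=; ring.
congr (_ * _ * _); apply: eq_bigr => i _.
rewrite -!powR_mulrn ?gs0 ?(ltW (s0 i))//.
have xD (x r s : R) : 0 < x -> x `^ r * x `^ s = x `^ (r + s).
  by move=> x0; rewrite powRD//; apply/implyP => _; rewrite gt_eqF.
have gsi : 0 < G i i * S U i i by rewrite mulr_gt0.
rewrite !xD// powRM ?ltW// -mulrA xD//.
rewrite natrB ?(ltnW (ltn_ord i))// -!natr1 /al /be.
by congr (_ `^ _ * _ `^ _); field.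
Qed.

Local Open Scope ereal_scope.

(** The weight on the right is a function of [G] times a function of [U], the source of
    independence; [H] will carry [fG] and the indicator of an event. *)
Lemma ge0_integral_GU (H : 'M[R]_p * 'M[R]_p -> \bar R) :
  measurable_fun setT H -> (forall z, 0 <= H z) ->
  \int[lebesgue_sym p \x lebesgue_sym p]_(W in @PD2 R p)
    (H (g_of S W, U_of W) * (det_weight W)%:E) =
  \int[lebesgue_low p \x lebesgue_sym p]_(z in LT p `*` PD_unit p)
    (H z * (G_weight z.1 * (2 ^+ p * U_weight z.2))%:E).
Proof.
move=> mH H0.
pose F W := H (g_chol S W, U_chol W) * (det_weight W)%:E.
have mF : measurable_fun setT F.
  apply: emeasurable_funM.
    apply: (measurableT_comp mH); apply/measurable_fun_pairP; split.
      exact: measurable_g_chol.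
    exact: measurable_U_chol.
  by apply/measurable_EFinP; exact: measurable_det_weight.
have F0 W : 0 <= F W by rewrite mule_ge0// lee_fin mulr_ge0// powR_ge0.
transitivity (\int[lebesgue_sym p \x lebesgue_sym p]_(W in @PD2 R p) F W).
  apply: eq_integral => W; rewrite inE => W12.
  by rewrite /F -g_cholE// -U_cholE.
rewrite (ge0_integral_PD2 SL mS mF F0); apply: eq_integral => -[G U].
rewrite inE => -[/= GL Uu]; have TL := LT_mul GL (SL Uu).
have zP : PD2 (congr_pair (G *m S U) U) by apply/PD2_congr_pair.
rewrite /F -g_cholE// -U_cholE// g_of_congr_pair// U_of_congr_pair//.
by rewrite -muleA -EFinM weight_congr_pair.
Qed.

End weights.

Section integral_lemmas.
Local Open Scope ereal_scope.
Context d (T : measurableType d) (R : realType).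
Variable mu : {measure set T -> \bar R}.

Lemma integral_EFin_pos (D : set T) (f : T -> R) :
  \int[mu]_(x in D) (Num.max (- f x) 0)%:E = 0 ->
  \int[mu]_(x in D) (f x)%:E = \int[mu]_(x in D) (Num.max (f x) 0)%:E.
Proof.
move=> f0; rewrite integralE.
rewrite [X in _ - X](_ : _ = 0) ?sube0; last first.
  by rewrite -[RHS]f0; apply: eq_integral => x _;
    rewrite funenegE EFin_max EFinN.
by apply: eq_integral => x _; rewrite funeposE EFin_max.
Qed.

End integral_lemmas.

Lemma integral_prod d1 d2 (T1 : measurableType d1) (T2 : measurableType d2)
    (R : realType) (m1 : {sigma_finite_measure set T1 -> \bar R})
    (m2 : {sigma_finite_measure set T2 -> \bar R}) (f : T1 -> R) (g : T2 -> R) :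
  measurable_fun setT f -> (forall x, 0 <= f x) ->
  measurable_fun setT g -> (forall y, 0 <= g y) ->
  (\int[m1 \x m2]_z (f z.1 * g z.2)%:E =
   \int[m1]_x (f x)%:E * \int[m2]_y (g y)%:E)%E.
Proof.
move=> mf f0 mg g0.
have mfg : measurable_fun setT (fun z : T1 * T2 => (f z.1 * g z.2)%:E).
  apply/measurable_EFinP; apply: measurable_funM.
    exact: (measurableT_comp mf measurable_fst).
  exact: (measurableT_comp mg measurable_snd).
rewrite fubini_tonelli1//; last by move=> z; rewrite lee_fin mulr_ge0.
rewrite -ge0_integralZr//.
- apply: eq_integral => x _; rewrite /fubini_F/=.
  under eq_integral do rewrite EFinM.
  by rewrite ge0_integralZl// ?lee_fin//; [exact/measurable_EFinP|move=> y _;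
    rewrite lee_fin].
- exact/measurable_EFinP.
- by move=> x _; rewrite lee_fin.
- by apply: integral_ge0 => y _; rewrite lee_fin.
Qed.

(** If [C] is the Cholesky factor of the Gram matrix of [invmx X], then [X *m C] and the identity
    have the same Gram matrix and both lie in [LT p], so they are equal. *)
Lemma LT_inv (R : realType) p (X : 'M[R]_p) : LT p X -> LT p (invmx X).
Proof.
move=> XL; have uX := LT_unit XL.
have uV : invmx X \in unitmx by rewrite unitmx_inv.
have PV : PD p (invmx X *m (invmx X)^T).
  by have := PD_congr uV (PD1 R p); rewrite mulmx1.
have [CL CC] := chol_gram PV; set C := chol _ in CL CC.
suff <- : C = invmx X by [].
have I1 : LT p (1%:M : 'M[R]_p).
  split=> [|i]; last by rewrite mxE eqxx.
  by apply/is_trig_mxP => i j ij; rewrite mxE -val_eqE/= ltn_eqF.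
have XC : X *m C = 1%:M.
  apply: gram_inj => //; first exact: LT_mul.
  rewrite trmx_mul mulmxA -(mulmxA X) CC !mulmxA mulmxV// mul1mx.
  by rewrite mul1mx -trmx_mul mulmxV.
by rewrite -[LHS](mulKmx uX) XC mulmx1.
Qed.

(** * The law of the decomposition *)

Section law.
Variables (R : realType) (p : nat) (a b : R).
Variables (S : 'M[R]_p -> 'M[R]_p) (fG : 'M[R]_p -> R).
Variables (d : measure_display) (Omega : measurableType d).
Variables (P : probability Omega R) (W : {RV P >-> ('M[R]_p * 'M[R]_p)%type}).
Hypothesis SL : forall U, PD_unit p U -> LT p (S U).
Hypothesis mS : measurable_fun (PD_unit p) S.
Hypothesis mfG : measurable_fun (LT p) fG.
Hypothesis WPD : forall w, PD2 (W w).
Hypothesis WE : forall A : set ('M[R]_p * 'M[R]_p), measurable A ->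
  distribution P W A =
  (\int[lebesgue_sym p \x lebesgue_sym p]_(x in A `&` @PD2 R p)
    (fG (g_of S x) * det_weight a b x)%:E)%E.

Let mW : measurable_fun setT W. Proof. exact: measurable_funPT. Qed.

Let mLT := @measurable_LT R p.
Let mPDu := @measurable_PD_unit R p.
Let mPD2 := @measurable_PD2 R p.

Definition fG0 : 'M[R]_p -> R := fG \_ (LT p).

Lemma measurable_fG0 : measurable_fun setT fG0.
Proof. exact/(measurable_restrictT fG mLT). Qed.

Lemma fG0E G : LT p G -> fG0 G = fG G.
Proof. by move=> GL; rewrite /fG0 patchE mem_set. Qed.

Lemma LT_g_of (x : 'M[R]_p * 'M[R]_p) : PD2 x -> LT p (g_of S x).
Proof.
move=> x12; apply: LT_mul; first exact: LT_T_of.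
by apply: LT_inv; apply: SL; exact: PD_unit_U_of.
Qed.

Definition fpos G := Num.max (fG0 G) 0.
Definition fneg G := Num.max (- fG0 G) 0.

Lemma measurable_fpos : measurable_fun setT fpos.
Proof.
apply: (@measurable_maxr _ _ _ _ fG0 (cst 0)) => //.
exact: measurable_fG0.
Qed.

Lemma measurable_fneg : measurable_fun setT fneg.
Proof.
apply: (@measurable_maxr _ _ _ _ (fun G => - fG0 G) (cst 0)) => //.
by apply: measurableT_comp => //; exact: measurable_fG0.
Qed.

Lemma fpos_ge0 G : 0 <= fpos G. Proof. by rewrite le_max lexx orbT. Qed.
Lemma fneg_ge0 G : 0 <= fneg G. Proof. by rewrite le_max lexx orbT. Qed.

(* [fG] is not assumed to be nonnegative, but the set [N] where the density is
   negative has a probability that is both nonnegative and nonpositive. *)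
Let N : set ('M[R]_p * 'M[R]_p) := @PD2 R p `&` [set x | fG0 (g_chol S x) < 0].

Let mN : measurable N.
Proof.
apply: measurableI => //; apply: measurable_set_bool.
apply: measurable_fun_ltr => //.
exact: (measurableT_comp measurable_fG0 (measurable_g_chol mS)).
Qed.

Let dw_ge0 (x : 'M[R]_p * 'M[R]_p) : 0 <= det_weight a b x.
Proof. by rewrite mulr_ge0 ?powR_ge0. Qed.

Let fG_chol (x : 'M[R]_p * 'M[R]_p) : PD2 x -> fG (g_of S x) = fG0 (g_chol S x).
Proof. by move=> x12; rewrite -g_cholE// fG0E//; exact: LT_g_of. Qed.

Local Open Scope ereal_scope.
Local Notation mu2 := (lebesgue_sym p \x lebesgue_sym p).

Let integral_N : \int[mu2]_(x in N) (- (fG (g_of S x) * det_weight a b x))%:E =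
  \int[mu2]_(x in @PD2 R p) (fneg (g_of S x) * det_weight a b x)%:E.
Proof.
rewrite [LHS]integral_mkcond [RHS]integral_mkcond; apply: eq_integral => x _.
rewrite !patchE; have [x12|x12] := pselect (PD2 x); last first.
  by rewrite !memNset// => -[].
rewrite (mem_set x12); case: ifPn.
  rewrite inE => -[_ /= x0]; rewrite /fneg -mulNr fG_chol// g_cholE//.
  by rewrite max_l// oppr_ge0 ltW.
rewrite notin_setE => xN; rewrite /fneg g_cholE// max_r ?mul0r//.
by rewrite oppr_le0 leNgt; apply/negP => x0; apply: xN.
Qed.

Lemma integral_fneg :
  distribution P W N = 0 /\
  \int[mu2]_(x in @PD2 R p) (fneg (g_of S x) * det_weight a b x)%:E = 0.
Proof.
have NN : N `&` @PD2 R p = N by apply/setIidPl => x [].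
have fN x : N x -> 0 <= (- (fG (g_of S x) * det_weight a b x))%:E.
  move=> [x12 /= x0]; rewrite lee_fin -mulNr mulr_ge0// oppr_ge0 fG_chol//.
  exact: ltW.
have PN : distribution P W N =
    - \int[mu2]_(x in N) (- (fG (g_of S x) * det_weight a b x))%:E.
  rewrite WE// NN -integral_ge0N//; apply: eq_integral => x _.
  by rewrite EFinN oppeK.
have P0 : 0 <= distribution P W N by [].
have I0 : 0 <= \int[mu2]_(x in N) (- (fG (g_of S x) * det_weight a b x))%:E.
  exact: integral_ge0.
have E0 : \int[mu2]_(x in N) (- (fG (g_of S x) * det_weight a b x))%:E = 0.
  by apply/eqP; rewrite eq_le I0 andbT -oppe_ge0 -PN.
by rewrite PN -integral_N E0 oppe0.
Qed.

(** [N] is a null set, and off it [fG] equals its positive part. *)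
Lemma distribution_fpos A : measurable A ->
  distribution P W A =
  \int[mu2]_(x in @PD2 R p) (\1_A x * fpos (g_of S x) * det_weight a b x)%:E.
Proof.
move=> mA; have [PN0 _] := integral_fneg.
have -> : distribution P W A =
    distribution P W (A `\` N) + distribution P W (A `&` N).
  exact: (measureDI (distribution P W) mA mN).
have -> : distribution P W (A `&` N) = 0.
  apply/eqP; rewrite eq_le measure_ge0 andbT -[leRHS]PN0 le_measure ?inE//.
  exact: measurableI.
rewrite adde0 WE; last exact: measurableD.
rewrite [LHS]integral_mkcond [RHS]integral_mkcond; apply: eq_integral => x _.
rewrite !patchE; have [x12|x12] := pselect (PD2 x); last first.
  by rewrite !memNset// => -[].
rewrite (mem_set x12) indicE.
have [xA|xA] := boolP (x \in A); last first.
  by rewrite !mul0r memNset// => -[[xA' _] _]; move: xA; rewrite notin_setE.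
rewrite mul1r /fpos fG_chol// g_cholE//; move: xA; rewrite inE => xA.
have [x0|x0] := ltP (fG0 (g_chol S x)) 0%R.
  by rewrite mul0r memNset// => -[[_ +] _]; apply; split.
rewrite mem_set//; split => //; split => // -[_ /=].
by rewrite ltNge x0.
Qed.

(** Not normalized: only the product of the total masses of [G_density] and [U_density] is 1.
    [G_defect] is the negative part, to be shown of integral 0. *)
Definition G_density G : R := fpos G * G_weight a b G.
Definition G_defect G : R := fneg G * G_weight a b G.
Definition U_density : 'M[R]_p -> R :=
  (fun U => 2 ^+ p * U_weight a b S U)%R \_ (PD_unit p).

Lemma G_density_ge0 G : (0 <= G_density G)%R.
Proof. by rewrite mulr_ge0 ?fpos_ge0// G_weight_ge0. Qed.

Lemma G_defect_ge0 G : (0 <= G_defect G)%R.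
Proof. by rewrite mulr_ge0 ?fneg_ge0// G_weight_ge0. Qed.

Lemma U_density_ge0 U : (0 <= U_density U)%R.
Proof.
rewrite /U_density patchE; case: ifP => // _.
by rewrite mulr_ge0 ?exprn_ge0// U_weight_ge0.
Qed.

Lemma measurable_G_density : measurable_fun setT G_density.
Proof.
apply: measurable_funM; first exact: measurable_fpos.
exact: measurable_G_weight.
Qed.

Lemma measurable_G_defect : measurable_fun setT G_defect.
Proof.
apply: measurable_funM; first exact: measurable_fneg.
exact: measurable_G_weight.
Qed.

Lemma measurable_U_density : measurable_fun setT U_density.
Proof.
apply/(measurable_restrictT _ mPDu); apply: measurable_funM => //.
exact: measurable_U_weight.
Qed.

Let fG0_out G : ~ LT p G -> fG0 G = 0%R.
Proof. by move=> nL; rewrite /fG0 patchE memNset. Qed.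

Lemma weights_patch (h : 'M[R]_p -> R) (k : 'M[R]_p * 'M[R]_p -> R) :
  (forall G, ~ LT p G -> h G = 0%R) ->
  \int[lebesgue_low p \x lebesgue_sym p]_(z in LT p `*` PD_unit p)
    ((k z * h z.1)%:E * (G_weight a b z.1 * (2 ^+ p * U_weight a b S z.2))%:E) =
  \int[lebesgue_low p \x lebesgue_sym p]_z
    (k z * (h z.1 * G_weight a b z.1 * U_density z.2))%:E.
Proof.
move=> h0; rewrite [LHS]integral_mkcond; apply: eq_integral => -[G U] _.
rewrite patchE /U_density patchE /=.
have [GL|GL] := pselect (LT p G); last first.
  by rewrite h0// !(mul0r, mulr0) memNset// => -[].
have [Uu|Uu] := pselect (PD_unit p U); last first.
  by rewrite (memNset Uu) !mulr0 memNset// => -[].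
by rewrite (mem_set Uu) mem_set// -EFinM; congr EFin; ring.
Qed.

Lemma distribution_GU (C : set ('M[R]_p * 'M[R]_p)) : measurable C ->
  P ((fun w => (g_of S (W w), U_of (W w))) @^-1` C) =
  \int[lebesgue_low p \x lebesgue_sym p]_z
    (\1_C z * (G_density z.1 * U_density z.2))%:E.
Proof.
move=> mC; pose A := (fun x => (g_chol S x, U_chol x)) @^-1` C.
have mgU : measurable_fun setT (fun x => (g_chol S x, U_chol x)).
  apply/measurable_fun_pairP; split; first exact: measurable_g_chol.
  exact: measurable_U_chol.
have mA : measurable A by rewrite -[X in measurable X]setTI; exact: mgU.
have -> : (fun w => (g_of S (W w), U_of (W w))) @^-1` C = W @^-1` A.
  by apply/seteqP; split => w; rewrite /A /preimage/= g_cholE// U_cholE.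
have -> : P (W @^-1` A) = distribution P W A by [].
pose H (z : 'M[R]_p * 'M[R]_p) := (\1_C z * fpos z.1)%:E.
have mH : measurable_fun setT H.
  apply/measurable_EFinP; apply: measurable_funM => //.
  exact: (measurableT_comp measurable_fpos measurable_fst).
have H0 z : 0 <= H z by rewrite lee_fin mulr_ge0// fpos_ge0.
rewrite distribution_fpos// -(weights_patch (h := fpos) \1_C); last first.
  by move=> G GL; rewrite /fpos fG0_out// maxxx.
rewrite -(ge0_integral_GU a b SL mS mH H0).
apply: eq_integral => x; rewrite inE => x12.
rewrite /H /= EFinM; congr (_%:E * _); congr (_ * _)%R.
by rewrite !indicE; congr (_%:R); rewrite g_cholE// U_cholE.
Qed.

Let alpha := \int[lebesgue_low p]_G (G_density G)%:E.
Let beta := \int[lebesgue_sym p]_U (U_density U)%:E.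

Lemma integral_densities : alpha * beta = 1.
Proof.
rewrite -(integral_prod (lebesgue_low p) (lebesgue_sym p) measurable_G_density G_density_ge0
  measurable_U_density U_density_ge0).
have := distribution_GU measurableT;
  rewrite preimage_setT probability_setT => ->.
by apply: eq_integral => z _; rewrite indicE in_setT mul1r.
Qed.

(** The constant [c_0], taken at first over the positive part of [fG]; [G_massE] identifies the
    two. *)
Definition G_mass : R := fine alpha.

(** In the extended reals a product of nonnegative factors equals 1 only if both are finite and
    positive: an infinite factor yields 0 or infinity. *)
Let alpha_beta : [/\ alpha = G_mass%:E, beta = (G_mass^-1)%:E & (0 < G_mass)%R].
Proof.
have a0 : 0 <= alpha by apply: integral_ge0 => G _;
  rewrite lee_fin G_density_ge0.
have b0 : 0 <= beta by apply: integral_ge0 => U _;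
  rewrite lee_fin U_density_ge0.
rewrite /G_mass; move: integral_densities a0 b0;
  move: alpha beta => [x| |] [y| |] //=;
  rewrite ?lee_fin.
- move=> [xy1] x0 y0; have xn0 : x != 0%R.
    by apply/eqP => x00; move/eqP: xy1; rewrite x00 mul0r eq_sym oner_eq0.
  split=> //; last by rewrite lt_neqAle eq_sym xn0.
  by congr EFin; rewrite -[LHS](mulKf xn0) xy1 mulr1.
- move=> + x0 _; rewrite mulry; case: (sgrP x) x0 => // _ _.
    by rewrite mul0e => /eqP; rewrite eqe eq_sym oner_eq0.
  by rewrite mul1e.
- move=> + _ y0; rewrite mulyr; case: (sgrP y) y0 => // _ _.
    by rewrite mul0e => /eqP; rewrite eqe eq_sym oner_eq0.
  by rewrite mul1e.
Qed.

(** The change of variables turns the vanishing integral of [fneg] over pairs into this one times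
    [beta], which is not 0. *)
Lemma integral_defect : \int[lebesgue_low p]_G (G_defect G)%:E = 0.
Proof.
have [_ b1 G_mass_gt0] := alpha_beta; have [_] := integral_fneg.
(* The factor 1 gives [H] the shape that [weights_patch] expects. *)
pose H (z : 'M[R]_p * 'M[R]_p) := (1 * fneg z.1)%:E.
have mH : measurable_fun setT H.
  apply/measurable_EFinP; apply: measurable_funM => //.
  exact: (measurableT_comp measurable_fneg measurable_fst).
have H0 z : 0 <= H z by rewrite lee_fin mulr_ge0// fneg_ge0.
rewrite (_ : \int[mu2]_(x in _) _ =
    \int[mu2]_(x in @PD2 R p) (H (g_of S x, U_of x) * (det_weight a b x)%:E));
      last first.
  by apply: eq_integral => x _; rewrite /H mul1r EFinM.
rewrite (ge0_integral_GU a b SL mS mH H0) /H (weights_patch (fun=> 1%R));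
  last first.
  by move=> G GL; rewrite /fneg fG0_out// oppr0 maxxx.
under eq_integral do rewrite mul1r.
rewrite (integral_prod (lebesgue_low p) (lebesgue_sym p) measurable_G_defect G_defect_ge0
  measurable_U_density U_density_ge0) -/beta b1 => /eqP.
by rewrite mule_eq0 orbC eqe invr_eq0 gt_eqF//= => /eqP.
Qed.

Lemma distribution_rectangle A B : measurable A -> measurable B ->
  P ((fun w => g_of S (W w)) @^-1` A `&` (fun w => U_of (W w)) @^-1` B) =
  \int[lebesgue_low p]_(G in A) (G_density G)%:E *
  \int[lebesgue_sym p]_(U in B) (U_density U)%:E.
Proof.
move=> mA mB; have := distribution_GU (measurableX mA mB).
rewrite [X in P X](_ : _ = (fun w => g_of S (W w)) @^-1` A `&`
  (fun w => U_of (W w)) @^-1` B)// => ->.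
rewrite (integral_mkcond A) (integral_mkcond B).
have E (X : set 'M[R]_p) (k : 'M[R]_p -> R) :
    (EFin \o k) \_ X = fun G => (\1_X G * k G)%:E.
  apply/funext => G; rewrite patchE indicE.
  by case: ifP => _; rewrite ?mul1r ?mul0r.
rewrite !E -integral_prod; last 4 first.
- apply: measurable_funM => //; exact: measurable_G_density.
- by move=> G; rewrite mulr_ge0// G_density_ge0.
- apply: measurable_funM => //; exact: measurable_U_density.
- by move=> U; rewrite mulr_ge0// U_density_ge0.
apply: eq_integral => z _; congr EFin.
rewrite (_ : \1_(A `*` B) z = \1_A z.1 * \1_B z.2 :> R)%R; first by ring.
by rewrite !indicE in_setX; case: (z.1 \in A); rewrite ?mul1r ?mul0r.
Qed.

Let mG : measurable_fun setT (fun w => g_of S (W w)).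
Proof.
rewrite (_ : (fun _ => _) = g_chol S \o W); last first.
  by apply/funext => w; rewrite /= g_cholE.
exact: (measurableT_comp (measurable_g_chol mS) mW).
Qed.

Let mU : measurable_fun setT (fun w => U_of (W w)).
Proof.
rewrite (_ : (fun _ => _) = @U_chol R p \o W); last first.
  by apply/funext => w; rewrite /= U_cholE.
exact: (measurableT_comp (@measurable_U_chol R p) mW).
Qed.

Let z_ofE w : z_of S (W w) = z_patch S (U_of (W w)).
Proof. by rewrite /z_of z_patchE//; exact: PD_unit_U_of. Qed.

Let mZ : measurable_fun setT (fun w => z_of S (W w)).
Proof.
rewrite (_ : (fun _ => _) = z_patch S \o (fun w => U_of (W w))); last first.
  by apply/funext => w; rewrite /= z_ofE.
exact: (measurableT_comp (measurable_z_patch mS) mU).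
Qed.

Lemma distribution_U B : measurable B ->
  P ((fun w => U_of (W w)) @^-1` B) =
  G_mass%:E * \int[lebesgue_sym p]_(U in B) (U_density U)%:E.
Proof.
move=> mB; have := distribution_rectangle measurableT mB.
by rewrite preimage_setT setTI => ->; have [<- _ _] := alpha_beta.
Qed.

Lemma distribution_G A : measurable A ->
  P ((fun w => g_of S (W w)) @^-1` A) =
  \int[lebesgue_low p]_(G in A) (G_density G)%:E * (G_mass^-1)%:E.
Proof.
move=> mA; have := distribution_rectangle mA measurableT.
by rewrite preimage_setT setIT => ->; have [_ <- _] := alpha_beta.
Qed.

Lemma independent_UG :
  independent_rv P (fun w => U_of (W w)) (fun w => g_of S (W w)).
Proof.
split=> // B A mB mA; rewrite setIC distribution_rectangle// distribution_U//.
rewrite distribution_G//; have [_ _ G_mass_gt0] := alpha_beta.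
rewrite [RHS]muleCA; congr (_ * _).
by rewrite (muleC G_mass%:E) -muleA -EFinM mulfV ?mule1// gt_eqF.
Qed.

Let preimage_Z B :
  (fun w => z_of S (W w)) @^-1` B =
    (fun w => U_of (W w)) @^-1` (z_patch S @^-1` B).
Proof. by apply/seteqP; split => w; rewrite /preimage/= z_ofE. Qed.

Let measurable_preimage_z B : measurable B -> measurable (z_patch S @^-1` B).
Proof.
by move=> mB; rewrite -[X in measurable X]setTI; exact: measurable_z_patch.
Qed.

Lemma independent_GZ :
  independent_rv P (fun w => g_of S (W w)) (fun w => z_of S (W w)).
Proof.
split=> // A B mA mB; rewrite preimage_Z setIC muleC.
by have [_ _ ->] := independent_UG => //; exact: measurable_preimage_z.
Qed.

(** The witness for the measure on [Zset S] is the law of [Z] itself. *)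
Let nuZ : probability ('M[R]_p * 'M[R]_p)%type R :=
  distribution P (mfun_Sub (mem_set mZ)).

Let nuZE D : measurable D -> nuZ D =
  G_mass%:E * \int[lebesgue_sym p]_U (\1_D (z_patch S U) * U_density U)%:E.
Proof.
move=> mD; rewrite [LHS](_ : _ = P ((fun w => z_of S (W w)) @^-1` D))//.
rewrite preimage_Z distribution_U//; last exact: measurable_preimage_z.
congr (_ * _); rewrite [LHS]integral_mkcond; apply: eq_integral => U _.
rewrite patchE indicE (_ : (U \in _) = (z_patch S U \in D)); last first.
  by apply/idP/idP; rewrite !inE.
by case: ifP => _; rewrite ?mul1r ?mul0r.
Qed.

Let nuZ_Zset : nuZ (Zset S) = 1.
Proof.
rewrite [LHS](_ : _ = P ((fun w => z_of S (W w)) @^-1` Zset S))//.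
rewrite (_ : _ @^-1` _ = setT) ?probability_setT//.
apply/seteqP; split => // w _; exists (U_of (W w)) => //.
exact: PD_unit_U_of.
Qed.

Let max_mulr0 (x y : R) : (0 <= y)%R -> (Num.max (x * y) 0 = Num.max x 0 * y)%R.
Proof. by move=> y0; rewrite maxr_pMl// mul0r. Qed.

Let G_density_out G : ~ LT p G -> G_density G = 0%R.
Proof. by move=> GL; rewrite /G_density /fpos fG0_out// maxxx mul0r. Qed.

Let G_defect_out G : ~ LT p G -> G_defect G = 0%R.
Proof. by move=> GL; rewrite /G_defect /fneg fG0_out// oppr0 maxxx mul0r. Qed.

Lemma G_massE : G_mass = (\int[lebesgue_low p]_(g in LT p) (fG g * G_weight a b g))%R.
Proof.
rewrite /G_mass /Rintegral; congr fine; rewrite [RHS]integral_EFin_pos.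
  rewrite [RHS]integral_mkcond; apply: eq_integral => G _; rewrite patchE.
  have [GL|GL] := pselect (LT p G); last by rewrite memNset// G_density_out.
  by rewrite mem_set// max_mulr0 ?G_weight_ge0// -fG0E.
rewrite -[RHS]integral_defect [LHS]integral_mkcond; apply: eq_integral => G _.
rewrite patchE; have [GL|GL] := pselect (LT p G);
  last by rewrite memNset// G_defect_out.
by rewrite mem_set// -mulNr max_mulr0 ?G_weight_ge0// -fG0E.
Qed.

(** The negative part of the signed integrand is bounded by the defect; on the whole space this
    integrates to the mass of the defect times that of [nuZ], which is 0. *)
Lemma integral_GZ (C : set ('M[R]_p * ('M[R]_p * 'M[R]_p))) : measurable C ->
  \int[lebesgue_low p \x nuZ]_(x in C `&` (LT p `*` Zset S))
    (G_mass^-1 * fG x.1 * G_weight a b x.1)%:E =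
  \int[lebesgue_low p \x nuZ]_x
    (\1_(C `&` (setT `*` Zset S)) x * (G_mass^-1 * G_density x.1))%:E.
Proof.
move=> mC; have [_ _ G_mass_gt0] := alpha_beta.
have ci0 : (0 <= G_mass^-1)%R by rewrite invr_ge0 ltW.
have cw G : (0 <= G_mass^-1 * G_weight a b G)%R
  by rewrite mulr_ge0// G_weight_ge0.
have mZs := measurable_Zset SL mS.
have mD : measurable (C `&` (LT p `*` Zset S)).
  by apply: measurableI => //; exact: measurableX.
rewrite integral_EFin_pos.
  rewrite [LHS]integral_mkcond; apply: eq_integral => -[G z] _.
  rewrite patchE indicE /=; have [GL|GL] := pselect (LT p G); last first.
    by rewrite memNset ?G_density_out ?mulr0// => -[_ []].
  rewrite (_ : ((G, z) \in C `&` (LT p `*` Zset S)) =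
      ((G, z) \in C `&` (setT `*` Zset S))); last first.
    by apply/idP/idP; rewrite !inE /= => -[? []].
  case: ifP => _; last by rewrite mul0r.
  rewrite mul1r (_ : G_mass^-1 * fG G * G_weight a b G =
    fG G * (G_mass^-1 * G_weight a b G))%R; last by ring.
  rewrite max_mulr0// -fG0E//.
  by congr EFin; rewrite /G_density /fpos; ring.
have md : measurable_fun setT (fun G => G_mass^-1 * G_defect G)%R.
  by apply: measurable_funM => //; exact: measurable_G_defect.
have md1 : measurable_fun setT
    (fun x : 'M[R]_p * ('M[R]_p * 'M[R]_p) => (G_mass^-1 * G_defect x.1 * 1)%:E).
  apply/measurable_EFinP; apply: measurable_funM => //.
  exact: (measurableT_comp md measurable_fst).
have d0 G : (0 <= G_mass^-1 * G_defect G)%R by rewrite mulr_ge0// G_defect_ge0.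
apply/eqP; rewrite eq_le; apply/andP; split; last first.
  by apply: integral_ge0 => x _; rewrite lee_fin le_max lexx orbT.
apply: (@le_trans _ _ (\int[lebesgue_low p \x nuZ]_x (G_mass^-1 * G_defect x.1 * 1)%:E)).
  rewrite [leLHS](_ : _ = \int[lebesgue_low p \x nuZ]_(x in C `&` (LT p `*` Zset S))
      (G_mass^-1 * G_defect x.1 * 1)%:E); last first.
    apply: eq_integral => -[G z]; rewrite inE => -[_ [/= GL _]].
    rewrite /= (_ : - (G_mass^-1 * fG G * G_weight a b G) =
      - fG G * (G_mass^-1 * G_weight a b G))%R; last by ring.
    rewrite max_mulr0// -fG0E//.
    by congr EFin; rewrite /G_defect /fneg; ring.
  apply: ge0_subset_integral => // x _.
  by rewrite lee_fin mulr1.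
rewrite (integral_prod (lebesgue_low p) nuZ (g := cst 1%R) md d0)//.
under eq_integral do rewrite EFinM.
rewrite ge0_integralZl//; last 2 first.
- by apply/measurable_EFinP; exact: measurable_G_defect.
- by move=> G _; rewrite lee_fin G_defect_ge0.
by rewrite integral_defect mule0 mul0e.
Qed.

(** Tonelli over [G] reduces an arbitrary event [C] to its sections, so no extension from rectangles
    is required. *)
Lemma distribution_GZ (C : set ('M[R]_p * ('M[R]_p * 'M[R]_p))) : measurable C ->
  P ((fun w => (g_of S (W w), z_of S (W w))) @^-1` C) =
  \int[lebesgue_low p \x nuZ]_x
    (\1_(C `&` (setT `*` Zset S)) x * (G_mass^-1 * G_density x.1))%:E.
Proof.
move=> mC; have [_ _ G_mass_gt0] := alpha_beta.
have mZs := measurable_Zset SL mS.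
set C' := C `&` _.
have mC' : measurable C' by apply: measurableI => //; exact: measurableX.
pose Cz := (fun x => (x.1, z_patch S x.2)) @^-1` C'.
have mpz : measurable_fun setT
    (fun x : 'M[R]_p * 'M[R]_p => (x.1, z_patch S x.2)).
  apply/measurable_fun_pairP; split; first exact: measurable_fst.
  exact: (measurableT_comp (measurable_z_patch mS) measurable_snd).
have mCz : measurable Cz by rewrite -[X in measurable X]setTI; exact: mpz.
(* [Z] has all its values in [Zset S], so [C] may be cut down to [C']; and [Z] is a function of [U],
   which makes this an event about [(G, U)]. *)
rewrite (_ : _ @^-1` C = (fun w => (g_of S (W w), U_of (W w))) @^-1` Cz);
  last first.
  apply/seteqP; split => w; rewrite /Cz /C' /preimage/= -z_ofE; last by case.
  move=> Cw; split=> //; split=> //=; exists (U_of (W w)) => //.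
  exact: PD_unit_U_of.
rewrite distribution_GU//.
have mGd := measurable_G_density; have mUd := measurable_U_density.
rewrite fubini_tonelli1; last 2 first.
- apply/measurable_EFinP; apply: measurable_funM => //; apply: measurable_funM.
    exact: (measurableT_comp mGd measurable_fst).
  exact: (measurableT_comp mUd measurable_snd).
- move=> z; rewrite lee_fin mulr_ge0//.
  by apply: mulr_ge0; [exact: G_density_ge0|exact: U_density_ge0].
rewrite fubini_tonelli1; last 2 first.
- apply/measurable_EFinP; apply: measurable_funM => //;
  apply: measurable_funM => //.
  exact: (measurableT_comp mGd measurable_fst).
- move=> z; rewrite lee_fin mulr_ge0//.
  by apply: mulr_ge0; [rewrite invr_ge0 ltW|exact: G_density_ge0].
apply: eq_integral => G _; rewrite /fubini_F /=.
pose CG := (fun z => (G, z)) @^-1` C'.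
have mCG : measurable CG.
  by rewrite -[X in measurable X]setTI; exact: (pair1_measurable G).
have mzU : measurable_fun setT (fun U => (\1_CG (z_patch S U) * U_density U)%:E).
  apply/measurable_EFinP; apply: measurable_funM => //.
  exact: (measurableT_comp (measurable_indic mCG) (measurable_z_patch mS)).
(* Both inner integrals measure the section of [C'] at [G]. The law of [U] carries the factor
   [G_mass], which [G_mass^-1] compensates. *)
transitivity ((G_mass^-1 * G_density G)%:E * nuZ CG).
  rewrite nuZE// -ge0_integralZl//; last 2 first.
  - by move=> U _; rewrite lee_fin mulr_ge0// U_density_ge0.
  - by rewrite lee_fin ltW.
  rewrite -ge0_integralZl//; last 3 first.
  - exact: emeasurable_funM.
  - by move=> U _; rewrite mule_ge0// lee_fin ?(ltW G_mass_gt0)// mulr_ge0// U_density_ge0.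
  - by rewrite lee_fin mulr_ge0// ?invr_ge0 ?(ltW G_mass_gt0)// G_density_ge0.
  apply: eq_integral => U _; rewrite -!EFinM; congr EFin.
  rewrite (_ : \1_Cz (G, U) = \1_CG (z_patch S U) :> R)%R; last by [].
  by field; rewrite gt_eqF.
rewrite -(setIT CG) -integral_indic// -ge0_integralZl//; last 2 first.
- by apply/measurable_EFinP; exact: measurable_indic.
- by rewrite lee_fin mulr_ge0// ?invr_ge0 ?(ltW G_mass_gt0)// G_density_ge0.
by apply: eq_integral => z _; rewrite -EFinM mulrC.
Qed.

Lemma distribution_U_density B : measurable B ->
  P ((fun w => U_of (W w)) @^-1` B) =
  \int[lebesgue_sym p]_(u in B `&` PD_unit p)
    (2 ^+ p * G_mass *
     \prod_(i < p) (S u i i) `^ (2 * (a + b) + p%:R - 2 * i.+1%:R + 1) *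
     (\det u) `^ (a - (p%:R + 1) / 2) *
     (\det (1%:M - u)) `^ (b - (p%:R + 1) / 2))%:E.
Proof.
move=> mB; have [_ _ G_mass_gt0] := alpha_beta.
rewrite distribution_U// -ge0_integralZl//; last 3 first.
- by apply: measurable_funTS; apply/measurable_EFinP;
  exact: measurable_U_density.
- by move=> U _; rewrite lee_fin U_density_ge0.
- by rewrite lee_fin ltW.
rewrite [LHS]integral_mkcond [RHS]integral_mkcond; apply: eq_integral => U _.
rewrite !patchE; have [UB|UB] := pselect (B U);
  last by rewrite !memNset// => -[].
have [Uu|Uu] := pselect (PD_unit p U); last first.
  rewrite (mem_set UB) /U_density patchE !memNset// ?mule0// => -[].
  by [].
rewrite (mem_set UB) /U_density patchE !mem_set// -EFinM; congr EFin.
by rewrite /U_weight; ring.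
Qed.

Lemma law_of_GZU :
  [/\ independent_rv P (fun w => g_of S (W w)) (fun w => z_of S (W w)),
      measurable (Zset S),
      exists2 nu : probability ('M[R]_p * 'M[R]_p)%type R,
        nu (Zset S) = 1 &
        forall C : set ('M[R]_p * ('M[R]_p * 'M[R]_p)), measurable C ->
          P ((fun w => (g_of S (W w), z_of S (W w))) @^-1` C) =
          \int[lebesgue_low p \x nu]_(x in C `&` (LT p `*` Zset S))
             (G_mass^-1 * fG x.1 * G_weight a b x.1)%:E &
      independent_rv P (fun w => U_of (W w)) (fun w => g_of S (W w))].
Proof.
split; [exact: independent_GZ|exact: measurable_Zset| |exact: independent_UG].
by exists nuZ => // C mC; rewrite distribution_GZ// -integral_GZ.
Qed.

End law.

Theorem theorem5p1 (R : realType) (p : nat) (a b : R)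
    (S : 'M[R]_p -> 'M[R]_p) (fG : 'M[R]_p -> R)
    (d : measure_display) (Omega : measurableType d) (P : probability Omega R)
    (W : {RV P >-> ('M[R]_p * 'M[R]_p)%type}) :
  (p%:R - 1) / 2 < a ->
  (p%:R - 1) / 2 < b ->
  (forall U, PD_unit p U -> LT p (S U)) ->
  measurable_fun (PD_unit p) S ->
  measurable_fun (LT p) fG ->
  (forall w, PD p (W w).1 /\ PD p (W w).2) ->
  (forall A : set ('M[R]_p * 'M[R]_p), measurable A ->
     distribution P W A =
     (\int[lebesgue_sym p \x lebesgue_sym p]_(x in A `&` (PD p `*` PD p))
        (fG (g_of S x) * (\det x.1) `^ (a - (p%:R + 1) / 2)
                       * (\det x.2) `^ (b - (p%:R + 1) / 2))%:E)%E) ->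
  let c0 : R := \int[lebesgue_low p]_(g in LT p)
      (fG g * \prod_(i < p) (g i i) `^ (2 * (a + b) - i.+1%:R)) in
  let G := fun w => g_of S (W w) in
  let Z := fun w => z_of S (W w) in
  let U := fun w => U_of (W w) in
  [/\ independent_rv P G Z,
      measurable (Zset S),
      exists2 nuZ : probability ('M[R]_p * 'M[R]_p)%type R,
        nuZ (Zset S) = 1%E &
        forall C : set ('M[R]_p * ('M[R]_p * 'M[R]_p)), measurable C ->
          P ((fun w => (G w, Z w)) @^-1` C) =
          (\int[lebesgue_low p \x nuZ]_(x in C `&` (LT p `*` Zset S))
             (c0^-1 * fG x.1 *
              \prod_(i < p) (x.1 i i) `^ (2 * (a + b) - i.+1%:R))%:E)%E,
      independent_rv P U G &
      forall B : set 'M[R]_p, measurable B ->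
        P (U @^-1` B) =
        (\int[lebesgue_sym p]_(u in B `&` PD_unit p)
           (2 ^+ p * c0 *
            \prod_(i < p) (S u i i) `^ (2 * (a + b) + p%:R
                                        - 2 * i.+1%:R + 1) *
            (\det u) `^ (a - (p%:R + 1) / 2) *
            (\det (1%:M - u)) `^ (b - (p%:R + 1) / 2))%:E)%E].
Proof.
move=> _ _ SL mS mfG WPD WE c0 G Z U.
have WE' (A : set ('M[R]_p * 'M[R]_p)) : measurable A -> distribution P W A =
    (\int[lebesgue_sym p \x lebesgue_sym p]_(x in A `&` @PD2 R p)
      (fG (g_of S x) * det_weight a b x)%:E)%E.
  by move=> mA; rewrite WE//; apply: eq_integral => x _; rewrite mulrA.
have -> : c0 = G_mass a b fG by rewrite (G_massE SL mS mfG WPD WE').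
have [GZ mZs nuE UG] := law_of_GZU SL mS mfG WPD WE'.
split=> // B mB.
exact: (distribution_U_density SL mS mfG WPD WE' mB).
Qed.
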